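(* Let $n\ge 1$, let $r_1,s_1>0$, and let $\mathbf{x}\sim\mathcal{N}(\mu,\Sigma_x)$ and $\mathbf{s}\sim\mathcal{N}(\bar s,\Sigma_s)$ be independent Gaussian random vectors in $\mathbb{R}^n$ with $\Sigma:=\Sigma_x+\Sigma_s$ positive definite. Let $P$ be an orthogonal matrix with $P^T\Sigma P=\mathrm{diag}(\lambda_1,\dots,\lambda_n)$ and let $b=(b_1,\dots,b_n)^T=P^T\Sigma^{-1/2}(\mu-\bar s)$. Define $$c_0=\exp\Big(-\tfrac12\sum_{i=1}^n b_i^2\Big)\prod_{i=1}^n(2\lambda_i)^{-1/2},\quad d_k=\tfrac12\sum_{i=1}^n(1-kb_i^2)(2\lambda_i)^{-k},\quad c_k=\frac1k\sum_{i=0}^{k-1}d_{k-i}c_i\quad(k\ge1).$$ Then the collision probability is $$\mathbb{P}\left(\|\mathbf{x}-\mathbf{s}\|^2\le (r_1+s_1)^2\right)=\sum_{k=0}^\infty(-1)^kc_k\frac{\left((r_1+s_1)^2\right)^{\frac n2+k}}{\Gamma\left(\frac n2+k+1\right)}.$$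
   Context: A robot and an obstacle are round bodies (disks or balls) with radii $r_1$ and $s_1$ and uncertain centres $\mathbf{x}$ and $\mathbf{s}$; they collide exactly when $\|\mathbf{x}-\mathbf{s}\|\le r_1+s_1$, where $\|\cdot\|$ is the Euclidean norm. $\Gamma$ is the gamma function, and $\Sigma^{-1/2}$ is the inverse of the symmetric positive definite square root of $\Sigma$. *)

(* Defs.v *)
From HB Require Import structures.
From mathcomp Require Import all_boot all_order all_algebra.
From mathcomp Require Import all_classical all_reals all_analysis.

Set Implicit Arguments.
Unset Strict Implicit.
Unset Printing Implicit Defensive.

Import Order.TTheory GRing.Theory Num.Theory.
Import numFieldNormedType.Exports.

Local Open Scope classical_set_scope.
Local Open Scope ring_scope.

Definition dotp (R : realType) (n : nat) (a v : 'cV[R]_n) : R :=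
  (a^T *m v) 0 0.

Definition quad_form (R : realType) (n : nat) (S : 'M[R]_n) (a : 'cV[R]_n) : R :=
  (a^T *m S *m a) 0 0.

(* The norm `|_| that the library puts on matrices is the max norm. *)
Definition enorm (R : realType) (n : nat) (v : 'cV[R]_n) : R :=
  Num.sqrt (\sum_i v i 0 ^+ 2).

Definition possemidef (R : realType) (n : nat) (S : 'M[R]_n) : Prop :=
  S^T = S /\ forall a : 'cV[R]_n, 0 <= quad_form S a.

Definition posdef (R : realType) (n : nat) (S : 'M[R]_n) : Prop :=
  S^T = S /\ forall a : 'cV[R]_n, a != 0 -> 0 < quad_form S a.

(* The symmetric positive definite square root; it exists and is unique when S
   is positive definite, and the default value 0 is used only otherwise. *)
Definition pd_sqrt (R : realType) (n : nat) (S : 'M[R]_n) : 'M[R]_n :=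
  xget 0 [set Q : 'M[R]_n | posdef Q /\ Q *m Q = S].

(* Euler's integral, meaningful for 0 < z only. *)
Definition Gamma (R : realType) (z : R) : R :=
  \int[lebesgue_measure]_(t in `]0, +oo[) (t `^ (z - 1) * expR (- t)).

(* Random vectors take values in n.-tuple R, which carries the product (Borel)
   sigma-algebra, whereas matrices carry no measurable structure. *)
Definition colvec (R : realType) (n : nat) (t : n.-tuple R) : 'cV[R]_n :=
  \col_i tnth t i.

(* The univariate normal law of mean m and variance v >= 0, which is the Dirac
   mass at m when v = 0.  The second argument of normal_prob is a standard
   deviation, and normal_prob m 0 is not degenerate but uniform on [0, 1]. *)
Definition normal_law (R : realType) (m v : R) (A : set R) : \bar R :=
  if v == 0 then \d_m A else normal_prob m (Num.sqrt v) A.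

(* X ~ N(mu, S), with S possibly singular: each linear combination <a, X> of the
   coordinates is univariate normal with mean <a, mu> and variance a^T S a. *)
Definition gaussian (d : measure_display) (T : measurableType d) (R : realType)
    (Pr : probability T R) (n : nat) (X : {RV Pr >-> n.-tuple R})
    (mu : 'cV[R]_n) (S : 'M[R]_n) : Prop :=
  possemidef S /\
  forall (a : 'cV[R]_n) (A : set R), measurable A ->
    Pr [set w | A (dotp a (colvec (X w)))] =
    normal_law (dotp a mu) (quad_form S a) A.

Definition independent (d d1 d2 : measure_display) (T : measurableType d)
    (T1 : measurableType d1) (T2 : measurableType d2) (R : realType)
    (Pr : probability T R) (X : {RV Pr >-> T1}) (Y : {RV Pr >-> T2}) : Prop :=
  forall (A : set T1) (B : set T2), measurable A -> measurable B ->
    Pr (X @^-1` A `&` Y @^-1` B) = (Pr (X @^-1` A) * Pr (Y @^-1` B))%E.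

(* Main.v *)
Require Import Defs.
From HB Require Import structures.
From mathcomp Require Import all_boot all_order all_algebra.
From mathcomp Require Import all_classical all_reals all_analysis.
From mathcomp Require Import measurable_realfun lebesgue_integral_under.
From mathcomp Require Import ring lra.

Set Implicit Arguments.
Unset Strict Implicit.
Unset Printing Implicit Defensive.

Import Order.TTheory GRing.Theory Num.Theory.
Import numFieldNormedType.Exports.

Local Open Scope classical_set_scope.
Local Open Scope ring_scope.

(** Write y = x - s and Q = |y|^2.  Only the laws of the linear forms <a, y> are
    given, so the expectation of cos(<a, y> + th) is known for all a and th.
    Since exp(-t z^2) cos Y is a Gaussian average over a of cos(a z + Y),
    Fubini's theorem turns the expectation of exp(-t Q) into an iterated
    Gaussian integral; in the coordinates z = P^T y this gives
      E exp(-t Q) = prod_i (1 + 2 t l_i)^(-1/2)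
                      exp(- t l_i b_i^2 / (1 + 2 t l_i)).
    With v = 1/t this is t^(-n/2) f(v), where f has logarithmic derivative
    sum_k (-1)^k d_k v^(k-1); the recurrence for c_k is the power series form of
    this equation, hence f(v) = sum_k (-1)^k c_k v^k for v small.  By Euler's
    integral the series F of the theorem, as a function of q = (r1 + s1)^2, has
    for large t the same Laplace transform as the distribution function of Q.
    Both are right-continuous, so they agree by Lerch's theorem. *)

(** * Gaussian averages of cosines *)

(** Either covariance alone may be singular and no joint density of y is given, so everything passes
    through one-dimensional laws. The free phase [th] lets real cosines do the work of
    characteristic functions: integrating out one variable changes only the phase, and averaging
    over a changes only one coefficient, so an induction on coordinates closes up. The obstacle at
    the other end is that f is singular at v = - 2 l_i, so its series and its closed form can be
    compared only for t beyond some s0. Two facts make this enough. Division by Gamma(n/2 + k + 1)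
    makes F converge for every q > 0. And Lerch's theorem needs the transform to vanish on [s0, +oo[
    only, because the approximate step functions that test against it are combinations of decaying
    exponentials, which raise the rate and never lower it. Right-continuity then gives equality at
    the chosen point itself, without any prior continuity of the distribution function of Q. *)

Lemma integral_derive_eq0 (R : realType) (h h' : R -> R) :
  (forall x, is_derive x (1 : R) h (h' x)) -> continuous h' ->
  (@lebesgue_measure R).-integrable setT (EFin \o h') ->
  h x @[x --> +oo] --> (0 : R) -> h x @[x --> -oo] --> (0 : R) ->
  (\int[lebesgue_measure]_x (h' x)%:E)%E = 0%E.
Proof.
move=> dh ch ih hy hNy.
have ch0 : continuous h.
  by move=> x; apply: differentiable_continuous; apply/derivable1_diffP.
(* The cut-offs live on nondegenerate intervals, hence [n.+1]. The fundamental theorem of calculus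
   turns their integrals into [h n.+1%:R - h (- n.+1%:R)], and domination by [|h'|] restores the
   integral over the line. *)
pose f n := EFin \o (h' \_ `[- n.+1%:R, n.+1%:R]).
have mh : measurable_fun setT h' by exact: continuous_measurable_fun.
have cvg1 : (\int[lebesgue_measure]_x f n x)%E @[n --> \oo] -->
    (\int[lebesgue_measure]_x (h' x)%:E)%E.
  apply: (@dominated_cvg _ _ R (@lebesgue_measure R) setT measurableT f (EFin \o h')
    (EFin \o (fun x => `|h' x|))).
  - move=> n; apply/measurable_EFinP.
    by apply/(measurable_restrictT _ _).1 => //; exact: measurable_funTS.
  - move=> x _; apply/cvg_EFin; first by apply: nearW.
    apply: cvg_near_cst; near=> n; rewrite /f /= patchE mem_set//=.
    rewrite in_itv/= -ler_norml.
    near: n; have [k hk q] := nbhs_infty_ger `|x|; exists k => // j /= kj.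
    by rewrite (le_trans (q _ kj))// ler_nat.
  - by [].
  - exact: integrable_norm.
  - by move=> n x _; rewrite lee_fin patchE; case: ifP => //; rewrite normr0.
apply: (cvg_unique _ cvg1) => //.
have -> : (fun n => (\int[lebesgue_measure]_x f n x)%E) =
   (fun n : nat => (h n.+1%:R - h (- n.+1%:R))%:E).
  apply/funext => n.
  rewrite (_ : (fun x => f n x) =
    (EFin \o h') \_ `[- n.+1%:R, n.+1%:R]%classic); last first.
    by apply/funext => x; rewrite /f/= !patchE; case: ifP.
  rewrite -integral_mkcond (@continuous_FTC2 _ h' h) ?EFinB//.
  - by rewrite gtrN// ltr0n.
  - exact: continuous_subspaceT.
  - split => //.
    + by apply: cvg_at_right_filter; exact: ch0.
    + by apply: cvg_at_left_filter; exact: ch0.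
  - by move=> x _; rewrite derive1E derive_val.
apply: cvg_EFin; first exact: nearW.
have cvgn1 : (n.+1%:R : R) @[n --> \oo] --> +oo.
  by have := @cvgr_idn R; rewrite -(cvg_shiftS (fun n => n%:R : R)).
rewrite /comp/= -[X in _ --> X](subrr (0 : R)); apply: cvgB.
- exact: (cvg_comp _ _ cvgn1 hy).
- move/cvgNy_compNP : hNy => hNy.
  exact: (cvg_comp _ _ cvgn1 hNy).
Unshelve. all: by end_near. Qed.

Lemma normal_pdf_is_derive (R : realType) (m s x : R) : s != 0 ->
  is_derive x (1 : R) (normal_pdf m s) (- ((x - m) / s ^+ 2 * normal_pdf m s x)).
Proof.
move=> s0; rewrite normal_pdfE//.
have -> : (fun x => normal_peak s * normal_fun m s x) =
    cst (normal_peak s) * (expR \o (cst (- (s ^+ 2 *+ 2)^-1) * (id - cst m) ^+ 2)).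
  by apply/funext => y; rewrite /normal_fun !fctE/=; congr (_ * expR _);
    rewrite !mulNr; congr (- _); rewrite mulrC.
apply: is_derive_eq; rewrite /GRing.scale/= !fctE /normal_fun.
have -> : - (x - m) ^+ 2 / (s ^+ 2 *+ 2) = - (s ^+ 2 *+ 2)^-1 * (x - m) ^+ 2.
  by rewrite !mulNr mulrC.
by rewrite expr1; field.
Qed.

(** Doubling the standard deviation leaves enough Gaussian decay to absorb the linear factor, so the
    first moment is dominated by a multiple of a normal density. *)
Lemma normal_pdf_linear_bound (R : realType) (m s x : R) : s != 0 ->
  `|(x - m) * normal_pdf m s x| <=
    `|s| * normal_peak s / normal_peak (2 * s) * normal_pdf m (2 * s) x.
Proof.
move=> s0; have s20 : 2 * s != 0 by rewrite mulf_neq0.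
rewrite !normal_pdfE// /normal_fun.
have p1 := normal_peak_gt0 s0; have p2 := normal_peak_gt0 s20.
rewrite [X in _ <= X]mulrA divfK ?gt_eqF// mulrCA mulrA normrM.
rewrite [X in _ * X <= _]ger0_norm ?expR_ge0//.
rewrite [X in X <= _](_ : _ = normal_peak s *
    (`|x - m| * expR (- (x - m) ^+ 2 / (s ^+ 2 *+ 2)))); last first.
  by rewrite normrM (gtr0_norm p1); ring.
rewrite [X in _ <= X](_ : _ = normal_peak s *
    (`|s| * expR (- (x - m) ^+ 2 / ((2 * s) ^+ 2 *+ 2)))); last ring.
rewrite ler_pM2l//.
(* 3/8 is 1/2 - 1/8, the gap between the exponents at widths s and 2 s. *)
have -> : - (x - m) ^+ 2 / ((2 * s) ^+ 2 *+ 2) =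
  3 / 8 * ((x - m) / s) ^+ 2 + - (x - m) ^+ 2 / (s ^+ 2 *+ 2) by field.
rewrite expRD mulrA ler_pM2r ?expR_gt0//.
rewrite (_ : `|x - m| = `|s| * `|(x - m) / s|); last first.
  by rewrite -normrM mulrC divfK.
rewrite ler_wpM2l//; apply: le_trans (expR_ge1Dx _).
rewrite -(real_normK (num_real ((x - m) / s))).
have : 0 <= `|(x - m) / s| by [].
(* 4/3 minimizes 1 + 3/8 u^2 - u, whose minimum is 1/3. *)
move: `|_| => u u0; have := sqr_ge0 (u - 4 / 3); nra.
Qed.

Lemma normal_moment1_integrable (R : realType) (m s : R) : s != 0 ->
  (@lebesgue_measure R).-integrable setT
    (fun x => ((x - m) * normal_pdf m s x)%:E).
Proof.
move=> s0.
have iC := @integrable_normal_pdf R m (2 * s).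
apply: le_integrable (integrableZl measurableT
  (`|s| * normal_peak s / normal_peak (2 * s)) iC) => //.
- apply/measurable_EFinP; apply: measurable_funM; last exact: measurable_normal_pdf.
  exact: measurable_funB.
- move=> x _; rewrite -EFinM lee_fin.
  rewrite (le_trans (normal_pdf_linear_bound _ _ s0))// ler_norm//.
Qed.

Lemma cvg_expr2_Ny (R : realType) : (x : R) ^+ 2 @[x --> -oo] --> +oo.
Proof.
apply/cvgNy_compNP; apply: cvg_trans (@cvgr_expr2 R).
by apply: near_eq_cvg; apply: nearW => x; rewrite /= sqrrN.
Qed.

Lemma normal_pdf_cvgy0 (R : realType) (m s : R) : s != 0 ->
  normal_pdf m s x @[x --> +oo] --> 0 /\ normal_pdf m s x @[x --> -oo] --> 0.
Proof.
move=> s0.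
have E : normal_pdf m s = (fun x => normal_peak s *
    expR (- ((s ^+ 2 *+ 2)^-1 * (x - m) ^+ 2))).
  rewrite normal_pdfE//; apply/funext => x.
  by rewrite /normal_fun mulNr [(x - m) ^+ 2 / _]mulrC.
have c0 : 0 < (s ^+ 2 *+ 2)^-1 by rewrite invr_gt0 pmulrn_lgt0// exprn_even_gt0.
rewrite E; split; rewrite -[X in _ --> X](mulr0 (normal_peak s)); apply: cvgMr.
- apply: (cvg_comp (fun x => (s ^+ 2 *+ 2)^-1 * (x - m) ^+ 2)
    (fun x => expR (- x))); last exact: cvgr_expR.
  apply: gt0_cvgMry => //.
  apply: (cvg_comp (fun x => x - m) (fun x => x ^+ 2)); last exact: cvgr_expr2.
  exact: cvg_addrr.
- apply: (cvg_comp (fun x => (s ^+ 2 *+ 2)^-1 * (x - m) ^+ 2)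
    (fun x => expR (- x))); last exact: cvgr_expR.
  apply: gt0_cvgMry => //.
  apply: (cvg_comp (fun x => x - m) (fun x => x ^+ 2)); last exact: cvg_expr2_Ny.
  exact: cvg_addrr_Ny.
Qed.

Section normal_cos.
Variables (R : realType) (m s Y : R).
Hypothesis s0 : s != 0.
Local Notation mu := (@lebesgue_measure R).

Lemma normal_mul_bounded_integrable (f : R -> R) : measurable_fun setT f ->
  (forall x, `|f x| <= 1) ->
  mu.-integrable setT (fun x => (normal_pdf m s x * f x)%:E).
Proof.
move=> mf f1; apply: le_integrable (integrable_normal_pdf m s) => //.
- by apply/measurable_EFinP/measurable_funM => //; exact: measurable_normal_pdf.
- move=> x _; rewrite lee_fin normrM (ger0_norm (normal_pdf_ge0 _ _ _)).
  by rewrite ler_piMr ?normal_pdf_ge0.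
Qed.

Lemma normr_cos_le1 (x : R) : `|cos x| <= 1.
Proof. by rewrite ler_norml cos_geN1 cos_le1. Qed.

Lemma normr_sin_le1 (x : R) : `|sin x| <= 1.
Proof. by rewrite ler_norml sin_geN1 sin_le1. Qed.

Lemma measurable_cos_comp d (T : measurableType d) (f : T -> R) :
  measurable_fun setT f -> measurable_fun setT (cos \o f).
Proof.
move=> mf; apply: measurableT_comp => //.
by apply: continuous_measurable_fun; exact: continuous_cos.
Qed.

Lemma measurable_sin_comp d (T : measurableType d) (f : T -> R) :
  measurable_fun setT f -> measurable_fun setT (sin \o f).
Proof.
move=> mf; apply: measurableT_comp => //.
by apply: continuous_measurable_fun; exact: continuous_sin.
Qed.

Lemma measurable_affine (z : R) : measurable_fun setT (fun x : R => z * (x - m) + Y).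
Proof.
apply: measurable_funD => //; apply: measurable_funM => //; exact: measurable_funB.
Qed.

Let f (z x : R) : R := normal_pdf m s x * cos (z * (x - m) + Y).
Let f' (z x : R) : R := - ((x - m) * normal_pdf m s x * sin (z * (x - m) + Y)).

Let df z x : is_derive z (1 : R) (f^~ x) (f' z x).
Proof.
have -> : f^~ x = cst (normal_pdf m s x) * (cos \o (cst (x - m) * id + cst Y)).
  by apply/funext => t; rewrite /f !fctE (mulrC t).
apply: is_derive_eq; rewrite /GRing.scale/= !fctE /f' (mulrC (x - m) z); ring.
Qed.

Let intf z : mu.-integrable setT (EFin \o f z).
Proof.
apply: normal_mul_bounded_integrable => [|x]; last exact: normr_cos_le1.
by apply: measurable_cos_comp; exact: measurable_affine.
Qed.

Let intf' z : mu.-integrable setT (EFin \o f' z).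
Proof.
apply: le_integrable (normal_moment1_integrable m s0) => //.
- apply/measurable_EFinP/measurableT_comp => //; apply: measurable_funM.
    apply: measurable_funM; [exact: measurable_funB|exact: measurable_normal_pdf].
  by apply: measurable_sin_comp; exact: measurable_affine.
- move=> x _; rewrite lee_fin normrN normrM ler_piMr//; exact: normr_sin_le1.
Qed.

Let g z := \int[mu]_x f z x.

(** Since the sine is at most 1 in absolute value, the first absolute moment bounds the z-derivative
    uniformly in z; any neighbourhood of z would serve for differentiating under the integral. *)
Let dg z : is_derive z (1 : R) g (\int[mu]_x f' z x).
Proof.
have Iz : `]z - 1, z + 1[%classic z by rewrite /= in_itv/=; apply/andP; split; lra.
have d1 (x : R) t : `]z - 1, z + 1[%classic t -> (setT : set R) x -> derivable (f^~ x) t 1 by [].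
have iG : mu.-integrable setT (EFin \o (fun x => `|(x - m) * normal_pdf m s x|)).
  exact: (integrable_norm (normal_moment1_integrable m s0)).
have E t x : partial1of2 f t x = f' t x.
  by rewrite /partial1of2 derive1E; have [_ ->] := df t x.
have ub t (x : R) : `]z - 1, z + 1[%classic t -> (setT : set R) x ->
    `|partial1of2 f t x| <= `|(x - m) * normal_pdf m s x|.
  by move=> _ _; rewrite E normrN normrM ler_piMr//; exact: normr_sin_le1.
have D := derivable_under_integral measurableT Iz (fun t _ => intf t)
  (fun t x => d1 x t) (fun x => normr_ge0 _) iG ub.
apply: DeriveDef; first exact: D.
rewrite -derive1E (differentiation_under_integral measurableT Iz
  (fun t _ => intf t) (fun t x => d1 x t) (fun x => normr_ge0 _) iG ub).
by apply: eq_Rintegral => x _; rewrite E.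
Qed.

Let intf'E z : \int[mu]_x f' z x = - (s ^+ 2 * z * g z).
Proof.
(* Integration by parts: [h] vanishes at both ends, so its derivative, a combination of [f'] and
   [f], has integral 0. *)
pose h (x : R) : R := normal_pdf m s x * sin (z * (x - m) + Y).
pose h' (x : R) : R := (s ^+ 2)^-1 * f' z x + z * f z x.
have dh (x : R) : is_derive x (1 : R) h (h' x).
  have -> : h = normal_pdf m s * (sin \o (cst z * (id - cst m) + cst Y)).
    by apply/funext => t; rewrite /h !fctE.
  have d1 := normal_pdf_is_derive m x s0.
  apply: is_derive_eq; rewrite /GRing.scale/= !fctE /h' /f' /f; field.
  exact: s0.
have ch' : continuous h'.
  have cp := @continuous_normal_pdf R m s s0.
  have ca (t : R) : (fun x => z * (x - m) + Y) x @[x --> t] --> z * (t - m) + Y.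
    apply: cvgD; last exact: cvg_cst.
    apply: cvgMr; apply: cvgB; [exact: cvg_id|exact: cvg_cst].
  move=> t; apply: cvgD; apply: cvgMr.
    apply: cvgN; apply: cvgM.
      apply: cvgM; last exact: cp.
      by apply: cvgB; [exact: cvg_id|exact: cvg_cst].
    by apply: (cvg_comp _ _ (ca t)); exact: continuous_sin.
  apply: cvgM; first exact: cp.
  by apply: (cvg_comp _ _ (ca t)); exact: continuous_cos.
have i1 : mu.-integrable setT (fun x => ((s ^+ 2)^-1)%:E * (f' z x)%:E)%E.
  exact: integrableZl (intf' z).
have i2 : mu.-integrable setT (fun x => z%:E * (f z x)%:E)%E.
  exact: integrableZl (intf z).
have ih' : mu.-integrable setT (EFin \o h') by exact: integrableD i1 i2.
have [py pNy] := normal_pdf_cvgy0 m s0.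
have h0 (F : set_system R) : Filter F -> normal_pdf m s x @[x --> F] --> (0 : R) ->
    h x @[x --> F] --> (0 : R).
  move=> FF pF; apply: norm_cvg0.
  apply: (squeeze_cvgr _ (cvg_cst 0) pF); apply: nearW => x; rewrite normr_ge0/=.
  rewrite normrM (ger0_norm (normal_pdf_ge0 _ _ _)).
  by rewrite ler_piMr ?normal_pdf_ge0 ?normr_sin_le1.
have Ih' := integral_derive_eq0 dh ch' ih' (h0 _ _ py) (h0 _ _ pNy); move: Ih'.
have E : (\int[mu]_x (h' x)%:E = ((s ^+ 2)^-1 * \int[mu]_x f' z x + z * g z)%:E)%E.
  rewrite (_ : (fun x => (h' x)%:E) =
    (fun x => ((s ^+ 2)^-1)%:E * (f' z x)%:E + z%:E * (f z x)%:E)%E)//.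
  rewrite integralD// integralZl//; last exact: intf'.
  rewrite integralZl//; last exact: intf.
  rewrite EFinD !EFinM /g /Rintegral !fineK//.
  - by apply: integrable_fin_num => //; exact: intf.
  - by apply: integrable_fin_num => //; exact: intf'.
rewrite E => Ih'.
have /eqP : (s ^+ 2)^-1 * (\int[mu]_x f' z x) + z * g z = 0.
  by apply: EFin_inj; rewrite Ih'.
rewrite addr_eq0 => /eqP H.
by rewrite -mulrA -mulrN -H mulrA divff ?mul1r// sqrf_eq0.
Qed.

Let g0 : g 0 = cos Y.
Proof.
rewrite /g /f; under eq_Rintegral do rewrite mul0r add0r mulrC.
rewrite RintegralZl//; last exact: integrable_normal_pdf.
by rewrite /Rintegral integral_normal_pdf/= mulr1.
Qed.

(** As a function of z the integral solves g' = - s^2 z g with g 0 = cos Y, so g(z) exp(s^2 z^2 / 2)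
    is constant. *)
Lemma normal_cosE (z : R) :
  (\int[mu]_x (normal_pdf m s x * cos (z * (x - m) + Y))%:E =
  (expR (- (s ^+ 2 * z ^+ 2 / 2)) * cos Y)%:E)%E.
Proof.
suff : g z = expR (- (s ^+ 2 * z ^+ 2 / 2)) * cos Y.
  rewrite /g /Rintegral => <-; rewrite fineK//.
  by apply: integrable_fin_num => //; exact: intf.
pose k := g * (expR \o (cst (s ^+ 2 / 2) * id ^+ 2)).
have dk (t : R) : is_derive t (1 : R) k 0.
  have dgt := dg t.
  by apply: is_derive_eq; rewrite /GRing.scale/= !fctE intf'E; field.
have := @is_derive_0_is_cst R k z 0 dk.
rewrite /k !fctE/= expr0n/= mulr0 expR0 mulr1 g0 => H.
rewrite expRN -H mulrC [s ^+ 2 * z ^+ 2 / 2]mulrAC mulfK// gt_eqF//; exact: expR_gt0.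
Qed.

End normal_cos.

(** Both [normal_pdf] and the Radon-Nikodym derivative integrate to [normal_prob] on every
    measurable set, hence agree almost everywhere. *)
Lemma integral_normal_prob (R : realType) (m s : R) (f : R -> \bar R) :
  (normal_prob m s).-integrable setT f ->
  (\int[normal_prob m s]_x f x =
   \int[lebesgue_measure]_x (f x * (normal_pdf m s x)%:E))%E.
Proof.
move=> /[dup] fi /integrableP[mf _].
have dom := @normal_prob_dominates R m s.
rewrite -(Radon_Nikodym_change_of_variables dom)//=.
apply: ae_eq_integral => //.
- exact: emeasurable_funM.
- by apply: emeasurable_funM => //; apply/measurable_EFinP; exact: measurable_normal_pdf.
- apply: ae_eqe_mul2l => /=.
  rewrite Radon_NikodymE//=.
  case: cid => /= h [h1 h2 h3].
  apply: integral_ae_eq => //=.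
  + by apply/measurable_EFinP; exact: measurable_normal_pdf.
  + by move=> E _ mE; rewrite -h3.
Qed.

Lemma finite_integrable_cos d (T : measurableType d) (R : realType)
    (nu : {finite_measure set T -> \bar R}) (f : T -> R) :
  measurable_fun setT f -> nu.-integrable setT (fun x => (cos (f x))%:E).
Proof.
move=> mf; apply: measurable_bounded_integrable => //.
- by rewrite fin_num_fun_lty//; exact: fin_num_measure.
- exact: measurable_cos_comp.
- by exists 1; split=> // M M1 x _ /=; rewrite (le_trans (normr_cos_le1 _))// ltW.
Qed.

(* [lebesgue_measure], hence [normal_prob], lives on [measurableTypeR R], whose
   measurable structure is not syntactically the default one on [R]. *)
Lemma integral_cos_normal_law (R : realType)
    (nu : probability (measurableTypeR R) R) (m v Y : R) :
  0 <= v -> (forall A, measurable A -> nu A = normal_law m v A) ->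
  (\int[nu]_x (cos (x + Y))%:E = (expR (- (v / 2)) * cos (m + Y))%:E)%E.
Proof.
move=> v0 nuE.
have mxY : measurable_fun setT (fun x : R => x + Y) by exact: measurable_funD.
have mc : measurable_fun setT (fun x : R => (cos (x + Y))%:E).
  by apply/measurable_EFinP; exact: measurable_cos_comp.
have [v00|vn0] := eqVneq v 0.
  rewrite (eq_measure_integral (\d_(m : measurableTypeR R))).
    by rewrite integral_dirac// diracT mul1e v00 mul0r oppr0 expR0 mul1r.
  by move=> A mA _; apply: etrans (nuE _ mA) _; rewrite /normal_law v00 eqxx.
transitivity (\int[normal_prob m (Num.sqrt v)]_x (cos (x + Y))%:E)%E.
  apply: eq_measure_integral.
  by move=> A mA _; apply: etrans (nuE _ mA) _; rewrite /normal_law (negbTE vn0).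
have s0 : Num.sqrt v != 0 by rewrite sqrtr_eq0 -ltNge lt_def vn0.
rewrite integral_normal_prob; last exact: finite_integrable_cos.
(* Shapes the right-hand side for [normal_cosE] at z = 1 with phase m + Y, for which 1 * (x - m) +
   (m + Y) is x + Y. *)
rewrite -[in RHS](sqr_sqrtr v0) -[in RHS](mulr1 (_ ^+ 2)) -[X in _ * X / 2](expr1n _ 2).
rewrite -(normal_cosE m (m + Y) s0); apply: eq_integral => x _.
by rewrite -EFinM mulrC mul1r addrA subrK.
Qed.

(** Independence makes the joint law a product measure. Integrating out V leaves a cosine of U with
    a shifted phase, so the one-variable formula applies a second time. *)
Lemma integral_cos_sub_independent d (T : measurableType d) (R : realType)
    (Pr : probability T R) (U V : {RV Pr >-> measurableTypeR R}) (m1 v1 m2 v2 th : R) :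
  0 <= v1 -> 0 <= v2 ->
  (forall A, measurable A -> Pr (U @^-1` A) = normal_law m1 v1 A) ->
  (forall A, measurable A -> Pr (V @^-1` A) = normal_law m2 v2 A) ->
  (forall A B, measurable A -> measurable B ->
    Pr (U @^-1` A `&` V @^-1` B) = Pr (U @^-1` A) * Pr (V @^-1` B))%E ->
  (\int[Pr]_w (cos (U w - V w + th))%:E =
    (expR (- ((v1 + v2) / 2)) * cos (m1 - m2 + th))%:E)%E.
Proof.
move=> v10 v20 UE VE UV.
pose f (p : measurableTypeR R * measurableTypeR R) : R := p.1 - p.2 + th.
have mf : measurable_fun setT f.
  by apply: measurable_funD => //; apply: measurable_funB.
have mUV : measurable_fun setT (fun w => (U w, V w)) by exact: measurable_fun_pair.
have mcf : measurable_fun setT (fun p => (cos (f p))%:E).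
  by apply/measurable_EFinP; exact: measurable_cos_comp.
have iPr : Pr.-integrable setT ((fun p => (cos (f p))%:E) \o (fun w => (U w, V w))).
  apply: finite_integrable_cos; exact: measurableT_comp.
transitivity (\int[pushforward Pr (fun w => (U w, V w))]_p (cos (f p))%:E)%E.
  by rewrite integral_pushforward.
rewrite (eq_measure_integral (distribution Pr U \x distribution Pr V)%E); last first.
  move=> A mA _; apply/esym; exact: product_measure_unique.
rewrite -integral12_prod_meas1; last first.
  apply: measurable_bounded_integrable => //.
  - have := product_measure1E (distribution Pr U) (distribution Pr V)
      measurableT measurableT.
    rewrite setXTT => E; rewrite [X in (X < _)%E]E.
    have PU := probability_setT (distribution Pr U).
    have PV := probability_setT (distribution Pr V).
    by rewrite [X in (X * _ < _)%E]PU [X in (_ * X < _)%E]PV mule1 ltry.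
  - exact/measurable_EFinP.
  - by exists 1; split=> // M M1 x _ /=; rewrite (le_trans (normr_cos_le1 _))// ltW.
rewrite /fubini_F.
under eq_integral => u _.
  rewrite (_ : (fun v => (cos (f (u, v)))%:E) =
    (fun v => (cos (v + (- u - th)))%:E)); last first.
    by apply/funext => v; rewrite -cosN /f/=; congr (cos _)%:E; ring.
  rewrite (@integral_cos_normal_law _ (distribution Pr V) m2 v2 _ v20 VE).
  rewrite (_ : m2 + (- u - th) = - (u + (th - m2))); last ring.
  rewrite cosN EFinM. over.
rewrite integralZl//; last first.
  by apply: finite_integrable_cos; exact: measurable_funD.
rewrite (@integral_cos_normal_law _ (distribution Pr U) m1 v1 _ v10 UE).
by rewrite -EFinM mulrA -expRD; congr (expR _ * cos _)%:E; field.
Qed.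

(** Here the frequency is the integration variable and x is fixed; the variance 2 t turns s^2 x^2 /
    2 into t x^2. *)
Lemma gauss_average_cos (R : realType) (t x Y : R) : 0 < t ->
  (\int[lebesgue_measure]_a (normal_pdf 0 (Num.sqrt (2 * t)) a * cos (a * x + Y))%:E =
  (expR (- (t * x ^+ 2)) * cos Y)%:E)%E.
Proof.
move=> t0; have t20 : 0 < 2 * t by rewrite mulr_gt0.
have s0 : Num.sqrt (2 * t) != 0 by rewrite gt_eqF// sqrtr_gt0.
rewrite (_ : t * x ^+ 2 = Num.sqrt (2 * t) ^+ 2 * x ^+ 2 / 2); last first.
  by rewrite sqr_sqrtr ?ltW//; field.
rewrite -(normal_cosE 0 Y s0); apply: eq_integral => a _.
by rewrite subr0 (mulrC x).
Qed.

(** Precisions add: 1 / (2 t) + l = (1 + 2 t l) / (2 t). The damped density is therefore (1 + 2 t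
    l)^(-1/2) times the normal density of variance 2 t', where t' = t / (1 + 2 t l). *)
Lemma gauss_average_damped_cos (R : realType) (t l m Y : R) : 0 < t -> 0 <= l ->
  (\int[lebesgue_measure]_a (normal_pdf 0 (Num.sqrt (2 * t)) a *
     (expR (- (a ^+ 2 * l / 2)) * cos (a * m + Y)))%:E =
  ((Num.sqrt (1 + 2 * t * l))^-1 * expR (- (t * m ^+ 2 / (1 + 2 * t * l))) * cos Y)%:E)%E.
Proof.
move=> t0 l0; have t20 : 0 < 2 * t by rewrite mulr_gt0.
have d0 : 0 < 1 + 2 * t * l by rewrite ltr_pwDl// mulr_ge0// ltW.
set d := 1 + 2 * t * l.
set t' := t / d.
have t'0 : 0 < t' by rewrite divr_gt0.
have s0 : Num.sqrt (2 * t) != 0 by rewrite gt_eqF// sqrtr_gt0.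
have s0' : Num.sqrt (2 * t') != 0 by rewrite gt_eqF// sqrtr_gt0 mulr_gt0.
transitivity (\int[lebesgue_measure]_a ((Num.sqrt d)^-1%:E *
    (normal_pdf 0 (Num.sqrt (2 * t')) a * cos (a * m + Y))%:E))%E.
  apply: eq_integral => a _; rewrite -EFinM; congr EFin.
  rewrite mulrA [RHS]mulrA; congr (_ * _).
  rewrite !normal_pdfE// /normal_fun/= [RHS]mulrA -[LHS]mulrA -expRD.
  congr (_ * expR _).
    rewrite /normal_peak !sqr_sqrtr ?ltW// ?mulr_gt0// ?invr_gt0//.
    rewrite -invfM -sqrtrM ?ltW//; congr (Num.sqrt _)^-1.
    by rewrite /t'; field; rewrite gt_eqF.
  rewrite !subr0 !sqr_sqrtr ?ltW// ?mulr_gt0// ?invr_gt0// /t' /d; field.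
  by rewrite !gt_eqF.
rewrite integralZl//; last first.
  apply: normal_mul_bounded_integrable => [|a]; last exact: normr_cos_le1.
  by apply: measurable_cos_comp; apply: measurable_funD => //; exact: measurable_funM.
rewrite gauss_average_cos// -EFinM !mulrA; congr (_ * expR _ * _)%:E.
by rewrite /t'; field; rewrite gt_eqF.
Qed.

Section laplace_induction.
Context d (T : measurableType d) (R : realType) (Pr : probability T R).
Variables (N : nat) (z : nat -> T -> R) (l m : nat -> R) (t : R).
Hypothesis mz : forall i, measurable_fun setT (z i).
Hypothesis l0 : forall i, 0 <= l i.
Hypothesis t0 : 0 < t.
Hypothesis cosz : forall (a : nat -> R) th,
  (\int[Pr]_w (cos (\sum_(0 <= i < N) a i * z i w + th))%:E =
   (expR (- (\sum_(0 <= i < N) a i ^+ 2 * l i / 2)) *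
    cos (\sum_(0 <= i < N) a i * m i + th))%:E)%E.

Let mu := @lebesgue_measure R.
(** [E k] holds the coordinates already squared and [X a k] the linear form in the remaining ones: k
    = 0 is the hypothesis [cosz], and k = N is the Laplace transform. *)
Let E k w := expR (- (t * \sum_(0 <= i < k) z i w ^+ 2)).
Let X (a : nat -> R) k w := \sum_(k <= i < N) a i * z i w.
Let phi i := (Num.sqrt (1 + 2 * t * l i))^-1 *
   expR (- (t * m i ^+ 2 / (1 + 2 * t * l i))).

Let mE k : measurable_fun setT (E k).
Proof.
apply: measurableT_comp => //; apply: measurableT_comp => //.
apply: measurable_funM => //; apply: measurable_sum => i.
exact: measurable_funX.
Qed.

Let mX a k : measurable_fun setT (X a k).
Proof. by apply: measurable_sum => i; exact: measurable_funM. Qed.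

Let E_le1 k w : E k w <= 1.
Proof.
rewrite -expR0 ler_expR oppr_le0 mulr_ge0 ?(ltW t0)// sumr_ge0// => i _.
exact: sqr_ge0.
Qed.

(* One coordinate at a time, exp(- t z_k^2) is replaced by a Gaussian average of
   cos(a z_k + ...), which only modifies the linear form under the cosine. *)
Lemma partial_laplace_cos k a th : (k <= N)%N ->
  (\int[Pr]_w (E k w * cos (X a k w + th))%:E =
   (\prod_(0 <= i < k) phi i *
    (expR (- (\sum_(k <= i < N) a i ^+ 2 * l i / 2)) *
    cos (\sum_(k <= i < N) a i * m i + th)))%:E)%E.
Proof.
elim: k a th => [|k IH] a th kN.
  rewrite [\prod_(0 <= i < 0) _]big_geq// mul1r -(cosz a th).
  apply: eq_integral => w _.
  by rewrite /E big_geq// mulr0 oppr0 expR0 mul1r.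
pose s := Num.sqrt (2 * t).
pose f (p : T * measurableTypeR R) : R :=
  E k p.1 * (normal_pdf 0 s p.2 * cos (p.2 * z k p.1 + (X a k.+1 p.1 + th))).
have mf : measurable_fun setT f.
  apply: measurable_funM; first exact: measurableT_comp (mE k) _.
  apply: measurable_funM.
    exact: measurableT_comp (measurable_normal_pdf 0 s) _.
  apply: measurable_cos_comp; apply: measurable_funD.
    by apply: measurable_funM => //; exact: measurableT_comp (mz k) _.
  by apply: measurable_funD => //; exact: measurableT_comp (mX a k.+1) _.
have f_le (p : T * measurableTypeR R) : `|f p| <= normal_pdf 0 s p.2.
  rewrite !normrM (ger0_norm (normal_pdf_ge0 _ _ _)) ger0_norm ?expR_ge0//.
  rewrite mulrCA ler_piMr ?normal_pdf_ge0// mulr_ile1// ?normr_cos_le1//.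
  exact: expR_ge0.
have mEf : measurable_fun setT (EFin \o f) by exact/measurable_EFinP.
(* [|f|] is at most a normal density in the second variable, so its double integral is at most the
   mass of [Pr]. *)
have if_ : (Pr \x mu)%E.-integrable setT (EFin \o f).
  apply/integrable12ltyP => //.
  apply: (@le_lt_trans _ _ (\int[Pr]_w (cst 1 w))%E); last first.
    by rewrite integral_cst// mul1e [X in (X < _)%E]probability_setT ltry.
  apply: ge0_le_integral => //.
  - by move=> w _; exact: integral_ge0.
  - apply: (@measurable_fun_fubini_tonelli_F _ _ _ _ _ mu (fun p => `|(f p)%:E|)%E) => //.
    exact: measurableT_comp.
  - move=> w _; rewrite /= -(integral_normal_pdf 0 s); apply: ge0_le_integral => //.
    + have mfw := @measurable_fun_pair2 _ _ _ _ _ _ f w mf.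
      by apply/measurable_EFinP; apply: measurableT_comp.
    + by apply/measurable_EFinP; exact: measurable_normal_pdf.
    + by move=> x _; rewrite lee_fin; exact: f_le.
transitivity (\int[Pr]_w \int[mu]_a (f (w, a))%:E)%E.
  apply: eq_integral => w _; rewrite /f/=.
  under eq_integral do rewrite EFinM.
  rewrite integralZl//; last first.
    apply: normal_mul_bounded_integrable => [|x]; last exact: normr_cos_le1.
    by apply: measurable_cos_comp; apply: measurable_funD => //; exact: measurable_funM.
  rewrite gauss_average_cos// -EFinM mulrA -expRD /E big_nat_recr//=.
  by rewrite mulrDr opprD.
rewrite (Fubini if_).
transitivity (\int[mu]_x ((\prod_(0 <= i < k) phi i *
  expR (- (\sum_(k.+1 <= i < N) a i ^+ 2 * l i / 2)))%:E *
  (normal_pdf 0 s x * (expR (- (x ^+ 2 * l k / 2)) *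
    cos (x * m k + (\sum_(k.+1 <= i < N) a i * m i + th))))%:E))%E.
  apply: eq_integral => x _; rewrite /f/=.
  (* The averaging variable becomes the coefficient of coordinate k, so the induction hypothesis is
     applied to [b]; this is why the induction generalizes [a]. *)
  pose b i := if i == k then x else a i.
  have bk (F : nat -> R -> R) : \sum_(k <= i < N) F i (b i) =
      F k x + \sum_(k.+1 <= i < N) F i (a i).
    rewrite big_ltn// /b eqxx; congr (_ + _); apply: eq_big_nat => i /andP[ki _].
    by rewrite gtn_eqF.
  have {}IH := IH b th (ltnW kN).
  rewrite (bk (fun i x => x ^+ 2 * l i / 2)) (bk (fun i x => x * m i)) in IH.
  transitivity ((normal_pdf 0 s x)%:E * \int[Pr]_w (E k w * cos (X b k w + th))%:E)%E.
    rewrite -integralZl//.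
      apply: eq_integral => w _; rewrite -EFinM; congr EFin.
      by rewrite mulrCA /X (bk (fun i x => x * z i w)) addrA.
    apply: measurable_bounded_integrable => //.
    + by rewrite [X in (X < _)%E]probability_setT ltry.
    + apply: measurable_funM => //; apply: measurable_cos_comp.
      exact: measurable_funD.
    + exists 1; split=> // M M1 w _ /=; rewrite (le_trans _ (ltW M1))//.
      by rewrite normrM mulr_ile1// ?normr_cos_le1// ger0_norm ?expR_ge0.
  rewrite IH -!EFinM; congr EFin.
  rewrite opprD expRD addrA; ring.
rewrite integralZl//; last first.
  apply: normal_mul_bounded_integrable => [|x].
    apply: measurable_funM.
      apply: measurableT_comp => //; apply: measurableT_comp => //.
      by do 2 apply: measurable_funM => //.
    by apply: measurable_cos_comp; apply: measurable_funD => //; exact: measurable_funM.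
  rewrite normrM mulr_ile1// ?normr_cos_le1// ger0_norm ?expR_ge0//.
  by rewrite -expR0 ler_expR oppr_le0 divr_ge0// mulr_ge0// sqr_ge0.
rewrite gauss_average_damped_cos// -EFinM big_nat_recr//=; congr EFin.
rewrite /phi; ring.
Qed.

Lemma laplace_sum_sqr :
  (\int[Pr]_w (expR (- (t * \sum_(0 <= i < N) z i w ^+ 2)))%:E =
   (\prod_(0 <= i < N) phi i)%:E)%E.
Proof.
have := partial_laplace_cos (fun=> 0) 0 (leqnn N).
have sum0 (F : nat -> R) : \sum_(N <= i < N) F i = 0 by rewrite big_geq.
rewrite !sum0 oppr0 expR0 addr0 cos0 !mulr1 => <-.
by apply: eq_integral => w _; rewrite /X sum0 addr0 cos0 mulr1.
Qed.

End laplace_induction.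

(** * Positive definite matrices *)

Section posdef.
Variables (R : realType) (n : nat).
Implicit Types (S M P : 'M[R]_n) (a : 'cV[R]_n) (l : 'rV[R]_n).

Lemma quad_form_conj S P a : quad_form S (P *m a) = quad_form (P^T *m S *m P) a.
Proof. by rewrite /quad_form trmx_mul !mulmxA. Qed.

Lemma quad_form_diag l a : quad_form (diag_mx l) a = \sum_i l 0 i * a i 0 ^+ 2.
Proof.
rewrite /quad_form -mulmxA mxE; apply: eq_bigr => i _.
by rewrite mul_diag_mx !mxE expr2 mulrCA.
Qed.

Lemma quad_formD S S' a : quad_form (S + S') a = quad_form S a + quad_form S' a.
Proof. by rewrite /quad_form mulmxDr mulmxDl mxE. Qed.

Lemma posdefD S S' : posdef S -> posdef S' -> posdef (S + S').
Proof.
move=> [sS pS] [sS' pS']; split; first by rewrite linearD/= sS sS'.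
by move=> a a0; rewrite quad_formD addr_gt0 ?pS ?pS'.
Qed.

Lemma posdef_unitmx S : posdef S -> S \in unitmx.
Proof.
move=> [_ pS]; rewrite -row_free_unit -kermx_eq0; apply: contraT.
move=> /rowV0Pn[v /sub_kermxP vS v0].
have /pS : v^T != 0 by rewrite trmx_eq0.
by rewrite /quad_form trmxK vS mul0mx mxE ltxx.
Qed.

Lemma posdef_conj S P : P \in unitmx -> posdef S -> posdef (P^T *m S *m P).
Proof.
move=> uP [sS pS]; split; first by rewrite !trmx_mul trmxK sS mulmxA.
move=> a a0; rewrite -quad_form_conj pS//; apply: contra_neq a0 => Pa0.
by rewrite -[a](mulKmx uP) Pa0 mulmx0.
Qed.

Lemma posdef_diag l : (forall i, 0 < l 0 i) -> posdef (diag_mx l).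
Proof.
move=> l0; split; first by rewrite tr_diag_mx.
move=> a a0; rewrite quad_form_diag.
have [i ai0] : exists i, a i 0 != 0.
  apply/existsP; rewrite -negb_forall; apply: contra a0 => /forallP a0.
  by apply/eqP/matrixP => i j; rewrite ord1 mxE; apply/eqP.
rewrite (bigD1 i)//= ltr_pwDl//.
  by rewrite mulr_gt0// exprn_even_gt0.
by apply: sumr_ge0 => j _; rewrite mulr_ge0 ?sqr_ge0// ltW.
Qed.

Lemma posdef_diag_gt0 l : posdef (diag_mx l) -> forall i, 0 < l 0 i.
Proof.
move=> [_ pl] i; have d0 : delta_mx i 0 != 0 :> 'cV[R]_n.
  by apply/eqP => /matrixP/(_ i 0)/eqP; rewrite !mxE !eqxx oner_eq0.
have := pl _ d0; rewrite quad_form_diag (bigD1 i)//= big1 ?addr0.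
  by rewrite mxE !eqxx expr1n mulr1.
by move=> j ji; rewrite mxE (negbTE ji) expr0n mulr0.
Qed.

Lemma sqr_diag_sqrt l : (forall i, 0 < l 0 i) ->
  diag_mx (map_mx Num.sqrt l) *m diag_mx (map_mx Num.sqrt l) = diag_mx l.
Proof.
move=> l0; apply/matrixP => i j; rewrite mul_diag_mx !mxE.
have [->|ij] := eqVneq i j; last by rewrite !mulr0n mulr0.
by rewrite !mulr1n -expr2 sqr_sqrtr// ltW.
Qed.

(** Once M and D commute, M^2 = D^2 factors as (M - D)(M + D) = 0, and M + D is positive definite,
    hence invertible. *)
Lemma posdef_sqr_diag M l : posdef M -> (forall i, 0 < l 0 i) ->
  M *m M = diag_mx l -> M = diag_mx (map_mx Num.sqrt l).
Proof.
move=> pM l0 MM; set D := diag_mx _.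
have sl0 i : 0 < Num.sqrt (l 0 i) by rewrite sqrtr_gt0.
have DD : D *m D = diag_mx l by exact: sqr_diag_sqrt.
have pD : posdef D by apply: posdef_diag => i; rewrite mxE.
(* M commutes with M^2, so it only mixes coordinates with equal l. *)
have MD : M *m D = D *m M.
  apply/matrixP => i j; rewrite mul_mx_diag mul_diag_mx !mxE mulrC.
  have : (M *m (M *m M)) i j = (M *m M *m M) i j by rewrite mulmxA.
  rewrite MM mul_mx_diag mul_diag_mx !mxE [LHS]mulrC => /eqP.
  rewrite -subr_eq0 -mulrBl mulf_eq0 subr_eq0 => /orP[/eqP->//|/eqP->].
  by rewrite !mulr0.
have : (M - D) *m (M + D) = 0.
  by rewrite mulmxDr !mulmxBl MM DD MD addrA subrK subrr.
move/(congr1 (mulmxr (invmx (M + D)))); rewrite /= mul0mx mulmxK.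
  by move/eqP; rewrite subr_eq0 => /eqP.
exact/posdef_unitmx/posdefD.
Qed.

(** Conjugating the diagonal of square roots back by P gives a witness, so [xget] does not fall back
    on its default 0. *)
Lemma pd_sqrtP S P l : P^T *m P = 1%:M -> posdef S ->
    P^T *m S *m P = diag_mx l ->
  posdef (pd_sqrt S) /\ pd_sqrt S *m pd_sqrt S = S.
Proof.
move=> oP pS dS; have PPt := mulmx1C oP.
have [uPt uP] := mulmx1_unit oP.
have l0 : forall i, 0 < l 0 i.
  by apply: posdef_diag_gt0; rewrite -dS; exact: posdef_conj.
pose D := diag_mx (map_mx Num.sqrt l).
have DD : D *m D = diag_mx l by exact: sqr_diag_sqrt.
apply: (@xgetPex _ 0 [set Q : 'M[R]_n | posdef Q /\ Q *m Q = S]).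
exists (P *m D *m P^T); split.
  rewrite -{1}[P]trmxK; apply: posdef_conj => //.
  by apply: posdef_diag => i; rewrite mxE sqrtr_gt0.
rewrite -!mulmxA (mulmxA P^T) oP mul1mx (mulmxA D) DD -dS.
by rewrite !mulmxA PPt mul1mx -mulmxA PPt mulmx1.
Qed.

Lemma orthogonal_diag_gt0 S P l : P^T *m P = 1%:M -> posdef S ->
  P^T *m S *m P = diag_mx l -> forall i, 0 < l 0 i.
Proof.
move=> oP pS dS; apply: posdef_diag_gt0; rewrite -dS; apply: posdef_conj => //.
by have [] := mulmx1_unit oP.
Qed.

(** By uniqueness of the positive square root, conjugation by P turns [pd_sqrt S] into the diagonal
    of the sqrt(l_i); coordinate i of [P^T *m v] is thus sqrt(l_i) b_i. *)
Lemma mahalanobis_coord S P l (v b : 'cV[R]_n) : P^T *m P = 1%:M -> posdef S ->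
    P^T *m S *m P = diag_mx l -> b = P^T *m invmx (pd_sqrt S) *m v ->
  forall i, (P^T *m v) i 0 ^+ 2 = l 0 i * b i 0 ^+ 2 :> R.
Proof.
move=> oP pS dS bE i; have PPt := mulmx1C oP.
have [uPt uP] := mulmx1_unit oP.
have l0 := orthogonal_diag_gt0 oP pS dS.
have [pQ QQ] := pd_sqrtP oP pS dS; set Q := pd_sqrt S in bE pQ QQ.
have ME : P^T *m Q *m P = diag_mx (map_mx Num.sqrt l).
  apply: posdef_sqr_diag => //; first exact: posdef_conj.
  by rewrite -dS -QQ -!mulmxA (mulmxA P P^T) PPt mul1mx.
have -> : P^T *m v = P^T *m Q *m P *m b.
  rewrite bE !mulmxA -(mulmxA _ P P^T) PPt mulmx1.
  by rewrite -(mulmxA P^T) mulmxV ?mulmx1 ?posdef_unitmx.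
rewrite ME mul_diag_mx !mxE exprMn sqr_sqrtr//; exact: ltW.
Qed.

End posdef.

(** * Laplace transform of the squared distance *)

Lemma dotpB (R : realType) (n : nat) (a u v : 'cV[R]_n) :
  dotp a (u - v) = dotp a u - dotp a v.
Proof. by rewrite /dotp mulmxBr !mxE. Qed.

Lemma dotpE (R : realType) (n : nat) (a v : 'cV[R]_n) :
  dotp a v = \sum_i a i 0 * v i 0.
Proof. by rewrite /dotp mxE; apply: eq_bigr => i _; rewrite mxE. Qed.

Lemma dotp_mulmx (R : realType) (n : nat) (P : 'M[R]_n) (a v : 'cV[R]_n) :
  dotp (P *m a) v = dotp a (P^T *m v).
Proof. by rewrite /dotp trmx_mul mulmxA. Qed.

Lemma enorm_sqr (R : realType) (n : nat) (v : 'cV[R]_n) :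
  enorm v ^+ 2 = dotp v v.
Proof.
rewrite /enorm sqr_sqrtr; last by apply: sumr_ge0 => i _; exact: sqr_ge0.
by rewrite dotpE; apply: eq_bigr => i _; rewrite expr2.
Qed.

Lemma enorm_orthogonal (R : realType) (n : nat) (P : 'M[R]_n) (v : 'cV[R]_n) :
  P^T *m P = 1%:M -> enorm v ^+ 2 = \sum_i ((P^T *m v) i 0) ^+ 2.
Proof.
move=> oP; rewrite enorm_sqr -{1}[v]mul1mx -(mulmx1C oP) -mulmxA dotp_mulmx.
by rewrite dotpE; apply: eq_bigr => i _; rewrite expr2.
Qed.

Lemma measurable_colvec d (T : measurableType d) (R : realType) (n : nat)
    (X : T -> n.-tuple R) (i : 'I_n) :
  measurable_fun setT X -> measurable_fun setT (fun w => colvec (X w) i 0).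
Proof.
move=> mX; under eq_fun do rewrite mxE.
exact: (measurableT_comp (measurable_tnth i) mX).
Qed.

Lemma measurable_dotp_colvec d (T : measurableType d) (R : realType) (n : nat)
    (X : T -> n.-tuple R) (a : 'cV[R]_n) :
  measurable_fun setT X -> measurable_fun setT (fun w => dotp a (colvec (X w))).
Proof.
move=> mX; under eq_fun do rewrite dotpE.
apply: measurable_sum => i; apply: measurable_funM => //.
exact: measurable_colvec.
Qed.

Section gaussian_difference.
Context d (T : measurableType d) (R : realType) (Pr : probability T R).
Variables (n : nat) (x s : {RV Pr >-> n.-tuple R}).
Variables (mu sbar : 'cV[R]_n) (Sx Ss : 'M[R]_n).
Hypothesis gx : gaussian x mu Sx.
Hypothesis gs : gaussian s sbar Ss.
Hypothesis xs : independent x s.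

Let y w := colvec (x w) - colvec (s w).

Lemma expectation_cos_gaussian_diff (a : 'cV[R]_n) (th : R) :
  (\int[Pr]_w (cos (dotp a (y w) + th))%:E =
   (expR (- (quad_form (Sx + Ss) a / 2)) * cos (dotp a (mu - sbar) + th))%:E)%E.
Proof.
have [[_ px] lx] := gx; have [[_ ps] ls] := gs.
have mx : measurable_fun setT x by exact: measurable_funPT.
have ms : measurable_fun setT s by exact: measurable_funPT.
have mU : measurable_fun setT (fun w => dotp a (colvec (x w)) : measurableTypeR R).
  exact: measurable_dotp_colvec.
have mV : measurable_fun setT (fun w => dotp a (colvec (s w)) : measurableTypeR R).
  exact: measurable_dotp_colvec.
pose U : {RV Pr >-> measurableTypeR R} :=
    @mfun_Sub _ _ _ (measurableTypeR R) _ (mem_set mU).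
pose V : {RV Pr >-> measurableTypeR R} :=
    @mfun_Sub _ _ _ (measurableTypeR R) _ (mem_set mV).
(* Events on U and V are events on the vectors x and s, through preimages under the measurable form
   [dotp a]. *)
have UV (A B : set (measurableTypeR R)) : measurable A -> measurable B ->
    (Pr (U @^-1` A `&` V @^-1` B) = Pr (U @^-1` A) * Pr (V @^-1` B))%E.
  move=> mA mB.
  have m1 : measurable_fun setT
      (fun t : n.-tuple R => dotp a (colvec t) : measurableTypeR R).
    exact: measurable_dotp_colvec.
  have mA' := m1 measurableT _ mA; have mB' := m1 measurableT _ mB.
  rewrite !setTI in mA' mB'; exact: xs mA' mB'.
have := @integral_cos_sub_independent _ _ _ Pr U V _ _ _ _ th
  (px a) (ps a) (lx a) (ls a) UV.
rewrite -quad_formD -dotpB => <-.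
by apply: eq_integral => w _; rewrite /y dotpB.
Qed.

Lemma laplace_sqr_enorm (P : 'M[R]_n) (l : 'rV[R]_n) (t : R) : (1 <= n)%N ->
    0 < t -> posdef (Sx + Ss) -> P^T *m P = 1%:M ->
    P^T *m (Sx + Ss) *m P = diag_mx l ->
  (\int[Pr]_w (expR (- (t * enorm (y w) ^+ 2)))%:E =
   (\prod_i ((Num.sqrt (1 + 2 * t * l 0 i))^-1 *
     expR (- (t * (P^T *m (mu - sbar)) i 0 ^+ 2 / (1 + 2 * t * l 0 i)))))%:E)%E.
Proof.
move=> n1 t0 pS oP dS.
have l0 := orthogonal_diag_gt0 oP pS dS.
(* The induction on coordinates uses indices in [nat]; [inord] brings them back to ordinals, which
   needs a dimension of the form [k.+1]. *)
case: n n1 x s mu sbar Sx Ss gx gs xs @y P l pS oP dS l0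
  expectation_cos_gaussian_diff => // k _.
move=> x' s' mu' sbar' Sx' Ss' _ _ _ y' P l pS oP dS l0 H.
pose z (i : nat) w := (P^T *m y' w) (inord i) 0.
have mz i : measurable_fun setT (z i).
  rewrite /z /y'; under eq_fun do rewrite mxE.
  apply: measurable_sum => j; apply: measurable_funM => //.
  under eq_fun do rewrite mxE [X in _ + X]mxE.
  by apply: measurable_funB; apply: measurable_colvec; exact: measurable_funPT.
have toord (F : 'I_k.+1 -> R) : \sum_(0 <= i < k.+1) F (inord i) = \sum_i F i.
  by rewrite big_mkord; apply: eq_bigr => i _; rewrite inord_val.
have cosz (a : nat -> R) th :
  (\int[Pr]_w (cos (\sum_(0 <= i < k.+1) a i * z i w + th))%:E =
   (expR (- (\sum_(0 <= i < k.+1) a i ^+ 2 * l 0 (inord i) / 2)) *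
    cos (\sum_(0 <= i < k.+1) a i * (P^T *m (mu' - sbar')) (inord i) 0 + th))%:E)%E.
  pose c : 'cV[R]_k.+1 := \col_i a i.
  have toc (F : nat -> R -> R) : \sum_(0 <= i < k.+1) F i (a i) =
      \sum_(i < k.+1) F i (c i 0).
    by rewrite big_mkord; apply: eq_bigr => i _; rewrite mxE.
  (* A linear form in the rotated coordinates is a linear form in the original ones, with
     coefficient vector P c; its variance is then diagonal. *)
  have dotc v : \sum_(0 <= i < k.+1) a i * (P^T *m v) (inord i) 0 = dotp (P *m c) v.
    rewrite (toc (fun i x => x * (P^T *m v) (inord i) 0)) dotp_mulmx dotpE.
    by apply: eq_bigr => i _; rewrite inord_val.
  rewrite dotc.
  have -> : \sum_(0 <= i < k.+1) a i ^+ 2 * l 0 (inord i) / 2 =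
      quad_form (Sx' + Ss') (P *m c) / 2.
    rewrite quad_form_conj dS quad_form_diag mulr_suml.
    rewrite (toc (fun i x => x ^+ 2 * l 0 (inord i) / 2)).
    by apply: eq_bigr => i _; rewrite inord_val (mulrC (l _ _)).
  rewrite -H; apply: eq_integral => w _; by rewrite /z dotc.
have l0' i : 0 <= l 0 (inord i) by exact/ltW/l0.
have := laplace_sum_sqr mz l0' t0 cosz.
rewrite big_mkord => L; apply: (etrans _ (etrans L _)).
  by apply: eq_integral => w _; rewrite (enorm_orthogonal _ oP) -toord.
by congr EFin; apply: eq_bigr => i _; rewrite inord_val.
Qed.

End gaussian_difference.

(** * Laplace transforms on the half-line *)

Lemma integral_expR_tail (R : realType) (t q : R) : 0 < t ->
  (\int[lebesgue_measure]_(x in `[q, +oo[) (expR (- (t * x)))%:E =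
   (expR (- (t * q)) / t)%:E)%E.
Proof.
move=> t0.
pose F := cst (- t^-1) * (expR \o (cst (- t) * id)) : R -> R.
have dF (x : R) : is_derive x (1 : R) F (expR (- (t * x))).
  apply: is_derive_eq; rewrite /GRing.scale/= !fctE (mulNr t).
  by field; rewrite gt_eqF.
have cF : continuous F.
  by move=> x; apply: differentiable_continuous; apply/derivable1_diffP.
rewrite (@ge0_continuous_FTC2y R (fun x => expR (- (t * x))) F q 0).
- by rewrite sub0e /F !fctE/= mulNr mulNr opprK mulrC.
- by move=> x _; exact: expR_ge0.
- apply: continuous_subspaceT => x.
  apply: (@continuous_comp _ _ _ (fun x => - (t * x)) expR); last exact: continuous_expR.
  by apply: cvgN; apply: cvgMr; exact: cvg_id.
- have -> : F = (fun x => - t^-1 * expR (- (t * x))).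
    by apply/funext => x; rewrite /F !fctE/= (mulNr t).
  rewrite -[X in _ --> X](mulr0 (- t^-1)); apply: cvgMr.
  apply: (cvg_comp (fun x => t * x) (fun x => expR (- x))); last exact: cvgr_expR.
  by apply: gt0_cvgMry.
- by [].
- by apply: cvg_at_right_filter; exact: cF.
- by move=> x _; rewrite derive1E derive_val.
Qed.

Section laplace_cdf.
Context d (T : measurableType d) (R : realType) (Pr : probability T R).
Variable Q : T -> R.
Hypothesis mQ : measurable_fun setT Q.
Hypothesis Q0 : forall w, 0 <= Q w.
Local Notation mu := (@lebesgue_measure R).
Let H (q : R) : R := fine (Pr [set w | Q w <= q]).

Let mQq q : measurable [set w | Q w <= q].
Proof.
rewrite -[X in measurable X]setTI; apply: (measurable_fun_le measurableT) => //.
Qed.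

Let HE q : (H q)%:E = Pr [set w | Q w <= q].
Proof. by rewrite /H fineK// fin_num_measure. Qed.

(** exp(- t Q) / t is the integral of exp(- t q) over q >= Q; Tonelli exchanges this integral with
    the expectation. *)
Lemma laplace_cdfE (t : R) : 0 < t ->
  (\int[mu]_(q in `]0%R, +oo[) (expR (- (t * q)) * H q)%:E =
   (t^-1)%:E * \int[Pr]_w (expR (- (t * Q w)))%:E)%E.
Proof.
move=> t0.
pose A : set (T * measurableTypeR R) := [set p | Q p.1 <= p.2].
have mA : measurable A.
  rewrite -[X in measurable X]setTI; apply: (measurable_fun_le measurableT) => //.
  exact: measurableT_comp.
pose f (p : T * measurableTypeR R) : \bar R := (expR (- (t * p.2)) * \1_A p)%:E.
have mf : measurable_fun setT f.
  apply/measurable_EFinP; apply: measurable_funM; last exact: measurable_indic.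
  apply: measurableT_comp => //; apply: measurableT_comp => //.
  exact: measurable_funM.
have f0 p : (0 <= f p)%E by rewrite lee_fin mulr_ge0 ?expR_ge0.
have := sfinite_Fubini Pr mu f f0 mf.
rewrite (_ : (fun w => _) = (fun w => (t^-1)%:E * (expR (- (t * Q w)))%:E)%E); last first.
  apply/funext => w.
  transitivity (\int[mu]_(y in `[Q w, +oo[) (expR (- (t * y)))%:E)%E.
    rewrite [RHS]integral_mkcond; apply: eq_integral => y _; rewrite /f patchE indicE/=.
    rewrite (_ : (w, y) \in A = (y \in `[Q w, +oo[%classic)); last first.
      by apply/idP/idP; rewrite !inE /A/= in_itv/= andbT.
    by case: (y \in _); rewrite /= ?mulr1 ?mulr0.
  by rewrite integral_expR_tail// -EFinM mulrC.
rewrite ge0_integralZl//; last 2 first.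
- apply/measurable_EFinP; apply: measurableT_comp => //; apply: measurableT_comp => //.
  exact: measurable_funM.
- by rewrite lee_fin invr_ge0 ltW.
move=> ->.
have mg := @measurable_fun_fubini_tonelli_G _ _ _ _ _ Pr f mf f0.
rewrite /fubini_G in mg; move: mg.
have -> : (fun q => (\int[Pr]_w f (w, q))%E) =
    (fun q => (expR (- (t * q)) * H q)%:E).
  apply/funext => q.
  transitivity (\int[Pr]_w ((expR (- (t * q)))%:E * (\1_[set w | Q w <= q] w)%:E))%E.
    apply: eq_integral => w _; rewrite /f -EFinM !indicE.
    by congr (_ * _ %:R)%:E; apply/idP/idP; rewrite !inE.
  rewrite ge0_integralZl//.
    by rewrite EFinM HE integral_indic// setIT.
  by apply/measurable_EFinP; exact: (measurable_indic (mQq q)).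
(* Tonelli yields an integral over the whole line. It reduces to the half-line since H vanishes for
   q < 0, and the endpoint 0, where H may be positive, is a null set. *)
move=> mg; rewrite [LHS]integral_itv_obnd_cbnd; last first.
  by apply/measurable_EFinP/measurable_funTS/measurable_EFinP; exact: mg.
rewrite [LHS]integral_mkcond; apply: eq_integral => q _.
rewrite patchE; case: ifPn => //; rewrite notin_setE/= in_itv/= andbT => /negP.
rewrite -ltNge => q0; congr EFin; rewrite /H (_ : [set w | _] = set0).
  by rewrite measure0 mulr0.
apply/seteqP; split => // w /= Qq; have := le_lt_trans (le_trans (Q0 w) Qq) q0.
by rewrite ltxx.
Qed.

End laplace_cdf.

(** * Lerch's theorem for transforms vanishing on a half-line *)

Lemma bernoulli_ineq (R : realDomainType) (y : R) (m : nat) : 0 <= y <= 1 ->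
  1 - m%:R * y <= (1 - y) ^+ m.
Proof.
move=> /andP[y0 y1]; elim: m => [|m IH]; first by rewrite mul0r subr0 expr0.
rewrite exprS; apply: (@le_trans _ _ ((1 - y) * (1 - m%:R * y))).
  rewrite -natr1; have := ler0n R m; nra.
by rewrite ler_wpM2l// subr_ge0.
Qed.

Lemma expr_onem_le_expR (R : realType) (y : R) (m : nat) : 0 <= y <= 1 ->
  (1 - y) ^+ m <= expR (- (m%:R * y)).
Proof.
move=> /andP[y0 y1]; rewrite -mulrN expRM_natl; apply: lerXn2r.
- by rewrite nnegrE subr_ge0.
- by rewrite nnegrE expR_ge0.
- exact: expR_ge1Dx.
Qed.

Section lerch.
Variable R : realType.
Local Notation mu := (@lebesgue_measure R).

(* For N large this approximates the indicator of q > r, and it is a linear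
   combination of the exponentials exp(- j N (ln 2 / r) q). *)
Let step (r : R) (N : nat) (q : R) : R :=
  (1 - expR (- (N%:R * (ln 2 / r) * q))) ^+ (2 ^ N).

Let ln2_gt0 : 0 < ln 2 :> R.
Proof. by rewrite ln_gt0// ltr1n. Qed.

Let y01 (r q : R) (N : nat) : 0 < r -> 0 <= q ->
  0 <= expR (- (N%:R * (ln 2 / r) * q)) <= 1.
Proof.
move=> r0 q0; rewrite expR_ge0/= expR_le1 oppr_le0 mulr_ge0//.
by rewrite mulr_ge0// divr_ge0 ?ltW//.
Qed.

(** The rate ln 2 / r is tuned so that 2^N copies of the exponential balance exactly at q = r. The
    product tends to 0 for q > r, where Bernoulli's inequality pushes [step] to 1, and to infinity
    for q < r, where (1 - y)^m <= exp(- m y) pushes it to 0. *)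
Let pow2E (r q : R) (N : nat) : 0 < r -> (2 ^ N)%:R * expR (- (N%:R * (ln 2 / r) * q)) =
  expR (N%:R * (ln 2 * (1 - q / r))).
Proof.
move=> r0; have -> : (2 ^ N)%:R = expR (N%:R * ln 2) :> R.
  by rewrite natrX expRM_natl lnK ?posrE.
by rewrite -expRD; congr expR; field; rewrite gt_eqF.
Qed.

Let cvg_expR_natl (a : R) : 0 < a -> expR (- (N%:R * a)) @[N --> \oo] --> (0 : R).
Proof.
move=> a0; rewrite (_ : (fun N => _) = (fun N => expR (- a) ^+ N)); last first.
  by apply/funext => N; rewrite -mulrN expRM_natl.
apply: cvg_expr; rewrite ger0_norm ?expR_ge0//.
by rewrite expR_lt1 oppr_lt0.
Qed.

Let step01 r N q : 0 < r -> 0 <= q -> 0 <= step r N q <= 1.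
Proof.
move=> r0 q0; have /andP[y0 y1] := y01 N r0 q0.
by rewrite /step exprn_ge0 ?subr_ge0//= exprn_ile1// ?subr_ge0// lerBlDr lerDl.
Qed.

Let step_cvg1 r q : 0 < r -> r < q -> step r N q @[N --> \oo] --> (1 : R).
Proof.
move=> r0 rq; have q0 : 0 <= q by rewrite ltW// (lt_trans r0).
have a0 : 0 < ln 2 * (q / r - 1) by rewrite mulr_gt0// subr_gt0 ltr_pdivlMr// mul1r.
have lo : 1 - expR (- (N%:R * (ln 2 * (q / r - 1)))) @[N --> \oo] --> (1 : R).
  rewrite -[X in _ --> X]subr0; apply: cvgB; first exact: cvg_cst.
  exact: cvg_expR_natl.
apply: squeeze_cvgr lo (cvg_cst (1 : R)); apply: nearW => N.
have /andP[_ ->] := step01 N r0 q0; rewrite andbT.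
apply: le_trans (bernoulli_ineq _ (y01 N r0 q0)).
rewrite pow2E// lerD2l lerN2 ler_expR le_eqVlt; apply/orP; left.
by apply/eqP; ring.
Qed.

Let step_cvg0 r q : 0 < r -> 0 <= q < r -> step r N q @[N --> \oo] --> (0 : R).
Proof.
move=> r0 /andP[q0 qr].
have a0 : 0 < ln 2 * (1 - q / r) by rewrite mulr_gt0// subr_gt0 ltr_pdivrMr// mul1r.
have hi := cvg_expR_natl a0.
apply: squeeze_cvgr (cvg_cst (0 : R)) hi; apply: nearW => N.
have /andP[-> _] := step01 N r0 q0; rewrite /=.
apply: (le_trans (expr_onem_le_expR _ (y01 N r0 q0))).
rewrite pow2E// ler_expR lerN2.
apply: (le_trans _ (expR_ge1Dx _)).
by rewrite lerDr.
Qed.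

(** The binomial expansion produces only rates at least s, so transforms on [s0, +oo[ determine the
    integral against [step]. *)
Let stepE r N q (s : R) : expR (- (s * q)) * step r N q =
  \sum_(j < (2 ^ N).+1) ((-1) ^+ j * 'C(2 ^ N, j)%:R) *
     expR (- ((s + j%:R * (N%:R * (ln 2 / r))) * q)).
Proof.
rewrite /step exprDn mulr_sumr; apply: eq_bigr => j _.
rewrite expr1n mul1r [(- expR _) ^+ _]exprNn -expRM_natl -mulr_natr.
have -> : expR (- ((s + j%:R * (N%:R * (ln 2 / r))) * q)) =
    expR (- (s * q)) * expR (j%:R * - (N%:R * (ln 2 / r) * q)).
  by rewrite -expRD; congr expR; ring.
by ring.
Qed.

Variables (D : R -> R) (s0 : R).
Hypothesis iD : mu.-integrable `]0, +oo[ (fun q => (expR (- (s0 * q)) * D q)%:E).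
Hypothesis laplaceD0 : forall s, s0 <= s ->
  (\int[mu]_(q in `]0%R, +oo[) (expR (- (s * q)) * D q)%:E = 0)%E.

Let mstep r N : measurable_fun setT (step r N).
Proof.
apply: measurable_funX; apply: measurable_funB => //.
by apply: measurableT_comp => //; apply: measurableT_comp => //.
Qed.

Lemma integrable_expR_mulS s : s0 <= s ->
  mu.-integrable `]0, +oo[ (fun q => (expR (- (s * q)) * D q)%:E).
Proof.
move=> ss; have mD : measurable_fun `](0 : R), +oo[ (fun q => expR (- (s0 * q)) * D q).
  by have /integrableP[/measurable_EFinP] := iD.
have E q : expR (- (s * q)) * D q = expR (- ((s - s0) * q)) * (expR (- (s0 * q)) * D q).
  by rewrite mulrA -expRD; congr (expR _ * _); ring.
apply: le_integrable iD => //.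
- apply/measurable_EFinP; rewrite (_ : (fun q => _) = (fun q => expR (- ((s - s0) * q)) *
    (expR (- (s0 * q)) * D q))); last exact/funext.
  apply: measurable_funM => //; apply: measurable_funTS.
  by apply: measurableT_comp => //; apply: measurableT_comp => //.
- move=> q /=; rewrite in_itv/= andbT => q0; rewrite lee_fin E normrM ler_piMl//.
  rewrite ger0_norm ?expR_ge0// -expR0 ler_expR oppr_le0 mulr_ge0 ?subr_ge0//.
  exact: ltW.
Qed.

Let int_step r N : 0 < r ->
  (\int[mu]_(q in `]0%R, +oo[) (expR (- (s0 * q)) * D q * step r N q)%:E = 0)%E.
Proof.
move=> r0.
pose a j := (-1) ^+ j * 'C(2 ^ N, j)%:R : R.
pose sj j := s0 + j%:R * (N%:R * (ln 2 / r)).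
have ssj j : s0 <= sj j.
  by rewrite lerDl mulr_ge0// mulr_ge0// divr_ge0 ?ltW//.
transitivity (\int[mu]_(q in `]0%R, +oo[)
    (\sum_(j < (2 ^ N).+1) ((a j)%:E * (expR (- (sj j * q)) * D q)%:E)))%E.
  apply: eq_integral => q _.
  rewrite mulrAC stepE mulr_suml sumEFin; congr EFin.
  by apply: eq_bigr => j _; exact/esym/mulrA.
rewrite integral_sum//; last by move=> j; apply: integrableZl => //; exact: integrable_expR_mulS.
rewrite big1// => j _; rewrite integralZl//; last exact: integrable_expR_mulS.
by rewrite laplaceD0// mule0.
Qed.

Let tail0 r : 0 < r ->
  (\int[mu]_(q in `]r, +oo[) (expR (- (s0 * q)) * D q)%:E = 0)%E.
Proof.
move=> r0.
pose g q := expR (- (s0 * q)) * D q.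
have mg : measurable_fun `](0 : R), +oo[ g by have /integrableP[/measurable_EFinP] := iD.
have mi : measurable_fun `](0 : R), +oo[ (\1_`](r : R), +oo[ : R -> R).
  by apply: measurable_funTS; exact: measurable_indic.
have mitv (i : interval R) : measurable [set` i] by exact: measurable_itv.
have step_le1 N q : `]0, +oo[%classic q -> (`|(g q * step r N q)%:E| <= `|g q|%:E)%E.
  rewrite /= in_itv/= andbT => q0; rewrite lee_fin normrM ler_piMr// ger0_norm.
    by have /andP[] := step01 N r0 (ltW q0).
  by have /andP[] := step01 N r0 (ltW q0).
have cvgs : {ae mu, forall q, `]0, +oo[%classic q ->
    (g q * step r N q)%:E @[N --> \oo] --> (g q * \1_`]r, +oo[ q)%:E}.
  (* At q = r the limit of [step] is 1/e, which is why the convergence is stated almost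
     everywhere. *)
  exists [set r]; split => //; first exact: lebesgue_measure_set1.
  move=> q /= /not_implyP[]; rewrite in_itv/= andbT => q0; apply: contra_notP => /eqP qr.
  apply: cvg_EFin; first exact: nearW.
  apply: cvgMr; rewrite indicE; have [rq|qr'] := ltP r q.
    by rewrite mem_set ?/= ?in_itv/= ?rq//; exact: step_cvg1.
  rewrite memNset ?/= ?in_itv/= ?andbT; last by apply/negP; rewrite -leNgt.
  by apply: step_cvg0 => //; rewrite (ltW q0) lt_neqAle qr.
have [|_ _] := @dominated_convergence _ _ R mu `]0, +oo[%classic (mitv _)
   (fun N q => (g q * step r N q)%:E) (fun q => (g q * \1_`]r, +oo[ q)%:E)
   (fun q => `|g q|%:E)
   (fun N => (measurable_EFinP _ _).2 (measurable_funM mg (measurable_funTS (mstep r N))))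
   ((measurable_EFinP _ _).2 (measurable_funM mg mi)) cvgs (integrable_norm iD) _.
  by apply: aeW => q N; exact: step_le1.
rewrite (_ : [sequence _]_n = cst 0%E); last first.
  by apply/funext => N; rewrite /= int_step.
move=> /(cvg_unique _ (cvg_cst _)) => /(_ (@ereal_hausdorff R)) E.
rewrite [RHS]E [in LHS](_ : `]r, +oo[%classic = `]0, +oo[ `&` `]r, +oo[)%classic.
  rewrite integral_mkcondr; apply: eq_integral => q _.
  by rewrite patchE indicE; case: (q \in _); rewrite /= ?mulr1 ?mulr0.
apply/seteqP; split => q /=; rewrite !in_itv/= !andbT.
  by move=> rq; rewrite rq (lt_trans r0).
by case.
Qed.

(** All tail integrals vanish, hence so does the integral over each ]r, r']. If D r > 0,
    right-continuity keeps D above D r / 2 just after r, and that integral would be positive. *)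
Lemma lerch_right_continuous_le0 (r : R) :
  0 < r -> D q @[q --> r^'+] --> D r -> D r <= 0.
Proof.
move=> r0 cD; rewrite leNgt; apply/negP => Dr0.
pose g q := expR (- (s0 * q)) * D q.
have d0 : 0 < D r / 2 by rewrite divr_gt0.
have Dr2 : D r / 2 < D r by lra.
have [e /= e0 he] := cvgr_gt (D r) cD (D r / 2) Dr2.
(* Half of [e] keeps the closed endpoint r' inside the neighbourhood. *)
pose r' := r + e / 2.
have rr' : r < r' by rewrite ltrDl divr_gt0.
have r'0 : 0 < r' by exact: lt_trans rr'.
have mg : measurable_fun `](0 : R), +oo[ g by have /integrableP[/measurable_EFinP] := iD.
have mgr : measurable_fun `](r : R), +oo[ g.
  apply: measurable_funS mg => //; apply: subset_itvr.
  by rewrite bnd_simp ltW.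
have U : `]r, +oo[%classic = `]r, r'] `|` `]r', +oo[ :> set R.
  by rewrite -itv_bndbnd_setU// bnd_simp ltW.
have : (\int[mu]_(q in `]r, r']) (g q)%:E = 0)%E.
  have := tail0 r0; rewrite U integral_setU//=; last 2 first.
  - by rewrite -U; exact/measurable_EFinP.
  - apply/disj_setPS => q /=; rewrite !in_itv/= andbT => -[/andP[_ q1] q2].
    by move: (le_lt_trans q1 q2); rewrite ltxx.
  by rewrite tail0// adde0.
apply/eqP; rewrite gt_eqF//.
(* A lower bound of g on ]r, r'] for either sign of s0, because s0 q <= |s0| r' there. *)
pose k := expR (- (`|s0| * r')) * (D r / 2).
have k0 : 0 < k by rewrite mulr_gt0// expR_gt0.
apply: (@lt_le_trans _ _ (\int[mu]_(q in `]r, r']) (cst k%:E q))%E).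
  rewrite integral_cst//= lebesgue_measure_itv/= lte_fin rr' -EFinD -EFinM lte_fin.
  by rewrite mulr_gt0// subr_gt0.
apply: ge0_le_integral => //.
- by move=> q _; rewrite lee_fin ltW.
- apply/measurable_EFinP; apply: measurable_funS mgr => //.
  by rewrite U; exact: subsetUl.
- move=> q /=; rewrite in_itv/= => /andP[rq qr'].
  rewrite lee_fin /k /g; apply: ler_pM; rewrite ?expR_ge0 ?(ltW d0)//.
    rewrite ler_expR lerN2 (le_trans (ler_norm _))// normrM.
    by rewrite ler_wpM2l// ger0_norm// ltW// (lt_trans r0).
  apply/ltW/he => //=; rewrite ltr0_norm ?subr_lt0// opprB.
  rewrite ltrBlDr (le_lt_trans qr')// /r' addrC ltrD2r.
  by rewrite ltr_pdivrMr// ltr_pMr// ltr1n.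
Qed.

End lerch.

Lemma lerch_right_continuous (R : realType) (D : R -> R) (s0 r : R) :
    lebesgue_measure.-integrable `]0, +oo[ (fun q => (expR (- (s0 * q)) * D q)%:E) ->
    (forall s, s0 <= s ->
      (\int[lebesgue_measure]_(q in `]0%R, +oo[) (expR (- (s * q)) * D q)%:E = 0)%E) ->
  0 < r -> D q @[q --> r^'+] --> D r -> D r = 0.
Proof.
move=> iD LD r0 cD; apply/eqP; rewrite eq_le.
rewrite (lerch_right_continuous_le0 iD LD r0 cD)/= -oppr_le0.
have E s : (fun q => (expR (- (s * q)) * - D q)%:E) =
    (fun q => (- 1)%:E * (expR (- (s * q)) * D q)%:E)%E.
  by apply/funext => q; rewrite -EFinM mulN1r mulrN.
apply: (@lerch_right_continuous_le0 R (fun q => - D q) s0) => //.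
- by rewrite E; exact: integrableZl.
- move=> s ss; rewrite E integralZl//; last exact: (integrable_expR_mulS iD).
  by rewrite LD// mule0.
- exact: cvgN.
Qed.

(** * Power series with exponential recurrences *)

(** The linear factor N is paid for by passing to a larger ratio p; with p between q and 1 this
    forces N q^N to 0. *)
Lemma nat_geometric_le (R : realDomainType) (p q : R) (N : nat) : 0 <= q -> q <= p ->
  N%:R * q ^+ N * (p - q) <= p ^+ N.+1.
Proof.
move=> q0 qp; have p0 := le_trans q0 qp.
elim: N => [|N IH]; first by rewrite !mul0r exprn_ge0.
rewrite -natr1 mulrDl mul1r mulrDl.
apply: (@le_trans _ _ (q * p ^+ N.+1 + p ^+ N.+1 * (p - q))).
  apply: lerD.
    rewrite [q ^+ N.+1]exprS mulrCA -2!mulrA.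
    by rewrite ler_wpM2l// mulrA.
  by rewrite ler_wpM2r ?subr_ge0// lerXn2r.
by rewrite mulrBr -exprSr mulrC addrC subrK.
Qed.

Lemma cvg_nat_geometric (R : realType) (q : R) : 0 <= q < 1 ->
  (N%:R * q ^+ N) @[N --> \oo] --> (0 : R).
Proof.
move=> /andP[q0 q1]; pose p := (1 + q) / 2.
have qp : q < p by rewrite /p; lra.
have p1 : p < 1 by rewrite /p; lra.
have p0 : 0 <= p by rewrite (le_trans q0)// ltW.
have h : (p - q)^-1 * p * p ^+ N @[N --> \oo] --> (0 : R).
  rewrite -[X in _ --> X](mulr0 ((p - q)^-1 * p)); apply: cvgMr.
  by apply: cvg_expr; rewrite ger0_norm.
apply: squeeze_cvgr (cvg_cst (0 : R)) h; apply: nearW => N.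
rewrite mulr_ge0 ?exprn_ge0//= -mulrA -exprS ler_pdivlMl ?subr_gt0// mulrC.
by apply: nat_geometric_le => //; exact: ltW.
Qed.

Lemma series_conv (R : comRingType) (x y : nat -> R) (N : nat) :
  \sum_(0 <= k < N) \sum_(0 <= i < k.+1) x i * y (k - i)%N =
  \sum_(0 <= i < N) x i * \sum_(0 <= j < N - i) y j.
Proof.
elim: N => [|N IH]; first by rewrite !big_nil.
rewrite big_nat_recr//= IH !big_nat_recr//= subnn subSnn big_nat1 addrA -big_split/=.
congr (_ + _); apply: eq_big_nat => i /andP[_ iN].
by rewrite subSn ?big_nat_recr ?mulrDr// ltnW.
Qed.

Lemma geometric_sum_le (R : realFieldType) (q : R) (m n : nat) : 0 <= q < 1 ->
  \sum_(m <= j < n) q ^+ j <= q ^+ m / (1 - q).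
Proof.
move=> /andP[q0 q1]; have q1' : 0 < 1 - q by rewrite subr_gt0.
rewrite ler_pdivlMr// mulrC; have [mn|nm] := leqP m n; last first.
  by rewrite big_geq 1?ltnW// mulr0 exprn_ge0.
rewrite mulr_sumr (eq_bigr (fun j => - (q ^+ j.+1 - q ^+ j))); last first.
  by move=> j _; rewrite mulrBl mul1r exprS opprB.
by rewrite sumrN telescope_sumr// opprB gerBl exprn_ge0.
Qed.

(** The product of partial sums exceeds the partial sum of the Cauchy product by the sum over i < N
    of x_i times the block of y from N - i to N. Each term is O(q^i q^(N-i)), so the defect is O(N
    q^N). *)
Lemma cauchy_product_geometric (R : realType) (x y : nat -> R) (C A q X Y : R) :
  0 <= q < 1 -> (forall k, `|x k| <= C * q ^+ k) -> (forall k, `|y k| <= A * q ^+ k) ->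
  series x @ \oo --> X -> series y @ \oo --> Y ->
  series (fun k => \sum_(0 <= i < k.+1) x i * y (k - i)%N) @ \oo --> X * Y.
Proof.
move=> q01 xb yb cX cY; have /andP[q0 q1] := q01.
have C0 : 0 <= C by apply: le_trans (normr_ge0 (x 0%N)) _; have := xb 0%N; rewrite expr0 mulr1.
have A0 : 0 <= A by apply: le_trans (normr_ge0 (y 0%N)) _; have := yb 0%N; rewrite expr0 mulr1.
have q1' : 0 < 1 - q by rewrite subr_gt0.
have cXY : (series x * series y) @ \oo --> X * Y by exact: cvgM.
suff d0 : (fun N => (series x * series y) N -
    series (fun k => \sum_(0 <= i < k.+1) x i * y (k - i)%N) N) @ \oo --> (0 : R).
  rewrite -[X in _ --> X]subr0; apply: cvg_trans (cvgB cXY d0).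
  apply: near_eq_cvg; apply: nearW => N; rewrite !fctE/=; ring.
apply: norm_cvg0.
have h : C * A / (1 - q) * (N%:R * q ^+ N) @[N --> \oo] --> (0 : R).
  rewrite -[X in _ --> X](mulr0 (C * A / (1 - q))); apply: cvgMr.
  exact: cvg_nat_geometric.
apply: squeeze_cvgr (cvg_cst (0 : R)) h; apply: nearW => N.
rewrite normr_ge0/= !fctE /series/= series_conv mulr_suml -sumrB.
apply: (le_trans (ler_norm_sum _ _ _)).
apply: (@le_trans _ _ (\sum_(0 <= i < N) C * A / (1 - q) * q ^+ N)); last first.
  by rewrite sumr_const_nat subn0 -mulrnAr mulr_natl.
apply: ler_sum_nat => i /andP[_ iN].
rewrite -mulrBr normrM.
rewrite (big_cat_nat (n := (N - i)%N)) ?leq_subr//= addrAC subrr add0r.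
apply: (@le_trans _ _ (C * q ^+ i * (A * (q ^+ (N - i) / (1 - q))))).
  apply: ler_pM => //.
  apply: (le_trans (ler_norm_sum _ _ _)).
  apply: (@le_trans _ _ (\sum_(N - i <= j < N) A * q ^+ j)).
    by apply: ler_sum => j _; exact: yb.
  by rewrite -mulr_sumr ler_wpM2l// geometric_sum_le.
rewrite -[in leRHS](subnKC (ltnW iN)) exprD le_eqVlt; apply/orP; left.
by apply/eqP; ring.
Qed.

Section pseries_bound.
Variables (R : realType) (a : nat -> R) (C K : R).
Hypothesis K0 : 0 < K.
Hypothesis ab : forall k, `|a k| <= C * K ^+ k.

Let C0 : 0 <= C.
Proof. by apply: le_trans (normr_ge0 (a 0%N)) _; have := ab 0%N; rewrite expr0 mulr1. Qed.

Lemma pseries_normed_cvg (x : R) : K * `|x| < 1 -> cvgn [normed pseries a x].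
Proof.
move=> Kx; have Kx0 : 0 <= K * `|x| by rewrite mulr_ge0// ltW.
apply: (@series_le_cvg R _ (geometric C (K * `|x|))).
- by move=> k; exact: normr_ge0.
- by move=> k; rewrite mulr_ge0// exprn_ge0.
- move=> k; rewrite /geometric/= normrM normrX exprMn mulrA.
  by rewrite ler_wpM2r// exprn_ge0.
- by apply: is_cvg_geometric_series; rewrite ger0_norm.
Qed.

Lemma pseries_cvg (x : R) : K * `|x| < 1 -> cvgn (pseries a x).
Proof. by move=> Kx; apply: normed_cvg; exact: pseries_normed_cvg. Qed.

End pseries_bound.

(** The factor k + 1 of a derived series is at most 2^k, so each derivation doubles the growth
    rate. *)
Lemma pseries_diffs_bound (R : realType) (a : nat -> R) (C K : R) : 0 < K ->
  (forall k, `|a k| <= C * K ^+ k) ->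
  forall k, `|pseries_diffs a k| <= C * K * (2 * K) ^+ k.
Proof.
move=> K0 ab k; have C0 : 0 <= C.
  by apply: le_trans (normr_ge0 (a 0%N)) _; have := ab 0%N; rewrite expr0 mulr1.
rewrite /pseries_diffs normrM ger0_norm//.
apply: (@le_trans _ _ ((2 ^ k)%:R * (C * K ^+ k.+1))).
  by apply: ler_pM => //; rewrite ler_nat ltn_expl.
by rewrite natrX exprMn exprS le_eqVlt; apply/orP; left; apply/eqP; ring.
Qed.

Lemma pseries_is_derive (R : realType) (a : nat -> R) (C K x : R) : 0 < K ->
    (forall k, `|a k| <= C * K ^+ k) -> 8 * K * `|x| < 1 ->
  is_derive x (1 : R) (fun x => limn (pseries a x)) (limn (pseries (pseries_diffs a) x)).
Proof.
move=> K0 ab Kx.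
have b1 := pseries_diffs_bound K0 ab.
have K20 : 0 < 2 * K by rewrite mulr_gt0.
have b2 := pseries_diffs_bound K20 b1.
have K40 : 0 < 2 * (2 * K) by rewrite mulr_gt0.
(* [pseries_snd_diffs] asks for convergence at z of the series and of its first two derived series,
   with rates K, 2 K and 4 K; here the ratios are 1/8, 1/4 and 1/2. *)
pose z := (8 * K)^-1.
have z0 : 0 < z by rewrite invr_gt0 mulr_gt0.
have zE : K * z = 1 / 8 by rewrite /z; field; rewrite gt_eqF.
apply: (@pseries_snd_diffs R a z); rewrite ?(gtr0_norm z0).
- by apply: (pseries_cvg K0 ab); rewrite gtr0_norm// zE; lra.
- by apply: (pseries_cvg K20 b1); rewrite gtr0_norm// -mulrA zE; lra.
- by apply: (pseries_cvg K40 b2); rewrite gtr0_norm// -!mulrA zE; lra.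
- by rewrite /z -[_^-1]mul1r ltr_pdivlMr ?mulr_gt0// mulrC.
Qed.

Lemma cvg_sum_seq (R : realType) (I : Type) (r : seq I) (f : I -> nat -> R) (l : I -> R) :
  (forall i, f i @ \oo --> l i) ->
  (fun N => \sum_(i <- r) f i N) @ \oo --> \sum_(i <- r) l i.
Proof.
move=> fl; elim: r => [|i r IH].
  by rewrite big_nil; under eq_fun do rewrite big_nil; exact: cvg_cst.
by rewrite big_cons; under eq_fun do rewrite big_cons; exact: cvgD.
Qed.

Section exp_recurrence.
Variables (R : realType) (n : nat) (w b : 'I_n -> R) (c e : nat -> R).
Hypothesis w0 : forall i, 0 < w i.
Hypothesis eE : forall k, (1 <= k)%N ->
  e k = 1 / 2 * \sum_(i < n) (1 - k%:R * b i ^+ 2) * w i ^+ k.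
Hypothesis cE : forall k, (1 <= k)%N ->
  c k = 1 / k%:R * \sum_(0 <= i < k) e (k - i)%N * c i.

(** In M each w_i is doubled to absorb the factor k of e_k, by k <= 2^k; A collects the weights 1 +
    b_i^2. K is chosen so that A M^j <= K^j for every j >= 1. *)
Let M := 1 + \sum_(i < n) 2 * w i.
Let A := \sum_(i < n) (1 + b i ^+ 2).
Let K := M * (1 + A).

Let M0 : 0 < M.
Proof.
by rewrite ltr_pwDl// sumr_ge0// => i _; rewrite mulr_ge0// ltW.
Qed.

Let A0 : 0 <= A.
Proof. by rewrite sumr_ge0// => i _; rewrite addr_ge0// sqr_ge0. Qed.

Let wM i : 2 * w i <= M.
Proof.
rewrite /M (bigD1 i)//= addrCA lerDl addr_ge0//.
by rewrite sumr_ge0// => j _; rewrite mulr_ge0// ltW.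
Qed.

Lemma exp_recurrence_coef_bound k : (1 <= k)%N -> `|e k| <= A * M ^+ k.
Proof.
move=> k1; rewrite eE// normrM ger0_norm//.
apply: (@le_trans _ _ (1 * \sum_(i < n) (1 + b i ^+ 2) * M ^+ k)); last first.
  by rewrite mul1r /A mulr_suml.
apply: ler_pM => //; first lra.
apply: (le_trans (ler_norm_sum _ _ _)); apply: ler_sum => i _.
rewrite normrM normrX (ger0_norm (ltW (w0 i))).
apply: (@le_trans _ _ ((1 + b i ^+ 2) * (2 * w i) ^+ k)); last first.
  by rewrite ler_wpM2l ?addr_ge0 ?sqr_ge0// lerXn2r ?nnegrE ?mulr_ge0// ltW.
rewrite exprMn [leRHS]mulrA ler_wpM2r ?exprn_ge0 ?(ltW (w0 i))//.
apply: (le_trans (ler_normB _ _)); rewrite normr1 normrM normrX.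
rewrite normr_nat real_normK ?num_real// mulrDl mul1r.
apply: lerD; first by rewrite exprn_ege1// ler1n.
by rewrite mulrC ler_wpM2l ?sqr_ge0// -natrX ler_nat ltnW// ltn_expl.
Qed.

Let K0 : 0 < K.
Proof. by rewrite mulr_gt0// ltr_pwDl. Qed.

(** The factor 1/k of the recurrence offsets its k terms, each of which is at most |c_0| K^k by
    strong induction. *)
Lemma exp_recurrence_bound k : `|c k| <= `|c 0%N| * K ^+ k.
Proof.
elim/ltn_ind: k => -[|k] IH; first by rewrite expr0 mulr1.
rewrite cE// mul1r normrM normfV normr_nat ler_pdivrMl//.
apply: (le_trans (ler_norm_sum _ _ _)).
apply: (@le_trans _ _ (\sum_(0 <= i < k.+1) `|c 0%N| * K ^+ k.+1)); last first.
  by rewrite sumr_const_nat subn0 mulr_natl.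
apply: ler_sum_nat => i /andP[_ ik]; rewrite normrM.
apply: (@le_trans _ _ (A * M ^+ (k.+1 - i) * (`|c 0%N| * K ^+ i))).
  by apply: ler_pM => //; [apply: exp_recurrence_coef_bound; rewrite subn_gt0|exact: IH].
rewrite mulrCA ler_wpM2l// -[in leRHS](subnK (ltnW ik)) exprD.
rewrite ler_wpM2r ?exprn_ge0 ?(ltW K0)// /K exprMn mulrC.
rewrite ler_wpM2l ?exprn_ge0 ?(ltW M0)//.
apply: (@le_trans _ _ (1 + A)); first by rewrite lerDr.
by rewrite ler_eXnr ?subn_gt0// lerDl.
Qed.

Lemma exp_recurrence_growth :
  exists2 K, 0 < K & forall k, `|c k| <= `|c 0%N| * K ^+ k.
Proof. by exists K => //; exact: exp_recurrence_bound. Qed.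

End exp_recurrence.

Lemma cvg_geometric (R : realType) (y : R) : `|y| < 1 ->
  series (fun k => y ^+ k) @ \oo --> (1 - y)^-1.
Proof.
move=> y1; rewrite -[X in _ --> X]mul1r; apply: cvg_trans (cvg_geometric_series y1).
by apply: near_eq_cvg; apply: nearW => N; apply: eq_bigr => k _; rewrite /geometric/= mul1r.
Qed.

(** This is the Cauchy square of the geometric series: coefficient k has k + 1 equal terms y^k. *)
Lemma cvg_diff_geometric (R : realType) (y : R) : `|y| < 1 ->
  series (fun k => k.+1%:R * y ^+ k) @ \oo --> (1 - y)^-1 ^+ 2.
Proof.
move=> y1; have yb k : `|y ^+ k| <= 1 * `|y| ^+ k by rewrite mul1r normrX.
have c := cvg_geometric y1.
have q01 : 0 <= `|y| < 1 by rewrite normr_ge0.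
have := cauchy_product_geometric q01 yb yb c c.
rewrite expr2 (_ : (fun k => \sum_(0 <= i < k.+1) y ^+ i * y ^+ (k - i)%N) =
  (fun k => k.+1%:R * y ^+ k))//.
apply/funext => k; rewrite (eq_big_nat _ _ (F2 := fun=> y ^+ k)).
  by rewrite sumr_const_nat subn0 mulr_natl.
by move=> i /andP[_ ik]; rewrite -exprD subnKC.
Qed.

Section exp_recurrence_sum.
Variables (R : realType) (n : nat) (w b : 'I_n -> R) (c e : nat -> R).
Hypothesis w0 : forall i, 0 < w i.
Hypothesis eE : forall k, (1 <= k)%N ->
  e k = 1 / 2 * \sum_(i < n) (1 - k%:R * b i ^+ 2) * w i ^+ k.
Hypothesis cE : forall k, (1 <= k)%N ->
  c k = 1 / k%:R * \sum_(0 <= i < k) e (k - i)%N * c i.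

Let M := 1 + \sum_(i < n) 2 * w i.
Let A := \sum_(i < n) (1 + b i ^+ 2).
Let K := M * (1 + A).

Let M1 : 1 <= M.
Proof. by rewrite lerDl sumr_ge0// => i _; rewrite mulr_ge0// ltW. Qed.

Let M0 : 0 < M. Proof. by rewrite (lt_le_trans _ M1). Qed.

Let A0 : 0 <= A.
Proof. by rewrite sumr_ge0// => i _; rewrite addr_ge0// sqr_ge0. Qed.

Let wM i : w i <= M.
Proof.
rewrite /M (bigD1 i)//= addrCA mulr_natl mulr2n -addrA lerDl addr_ge0 ?ltW//.
by rewrite ltr_pwDl// sumr_ge0// => j _; rewrite mulr_ge0// ltW.
Qed.

Let MK : M <= K.
Proof. by rewrite /K mulrDr mulr1 lerDl mulr_ge0// ltW. Qed.

Let K0 : 0 < K. Proof. exact: lt_le_trans MK. Qed.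

Let a k := (-1) ^+ k * c k.
Let dd k := (-1) ^+ k.+1 * e k.+1.

Let ab k : `|a k| <= `|c 0%N| * K ^+ k.
Proof.
by rewrite normrM normrX normrN1 expr1n mul1r; exact: (exp_recurrence_bound w0 eE cE).
Qed.

Let ddb k : `|dd k| <= A * M * M ^+ k.
Proof.
rewrite normrM normrX normrN1 expr1n mul1r -mulrA -exprS.
exact: (exp_recurrence_coef_bound w0 eE).
Qed.

(** Normalized to vanish at 0, so that c_0 exp(E) is the closed form of the series. Expanding its
    derivative [E'] by the geometric series and its square gives exactly the coefficients [dd]. *)
Let E (x : R) := \sum_(i < n) (- (1 / 2) * ln (1 + w i * x) +
  1 / 2 * b i ^+ 2 * (1 - (1 + w i * x)^-1)).
Let E' (x : R) := \sum_(i < n) (- (1 / 2) * w i * (1 + w i * x)^-1 +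
  1 / 2 * b i ^+ 2 * w i * (1 + w i * x)^-1 ^+ 2).

Let dE (x : R) : 0 <= x -> is_derive x (1 : R) E (E' x).
Proof.
move=> x0; rewrite (_ : E = \sum_(i < n) (cst (- (1 / 2)) * (@ln R \o (cst 1 + cst (w i) * id)) +
    cst (1 / 2 * b i ^+ 2) * (cst 1 - (fun y => (1 + w i * y)^-1)))); last first.
  by apply/funext => y; rewrite /E fct_sumE.
apply: (@is_derive_sum R R R n _ x 1 (fun i => - (1 / 2) * w i * (1 + w i * x)^-1 +
  1 / 2 * b i ^+ 2 * w i * (1 + w i * x)^-1 ^+ 2)) => i.
have p0 : 0 < 1 + w i * x by rewrite ltr_pwDl// mulr_ge0// ltW.
have d1 : is_derive ((cst 1 + cst (w i) * id) x) (1 : R) (@ln R) (1 + w i * x)^-1.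
  exact: is_derive1_ln.
have d3 : is_derive x (1 : R) (cst 1 + cst (w i) * id : R -> R) (w i).
  by apply: is_derive_eq; rewrite /GRing.scale/= ?fctE; ring.
have d2 : is_derive x (1 : R) (fun y => (1 + w i * y)^-1) (- (1 + w i * x) ^- 2 * w i).
  by apply: (@is_deriveV R (cst 1 + cst (w i) * id)) => //; rewrite gt_eqF.
apply: is_derive_eq; rewrite /GRing.scale/= !fctE; field.
by rewrite gt_eqF.
Qed.

Let cvg_dd (x : R) : M * `|x| < 1 -> 0 <= x -> series (fun k => dd k * x ^+ k) @ \oo --> E' x.
Proof.
move=> Mx x0; rewrite /E'.
have yi i : `| - (w i * x)| < 1.
  rewrite normrN normrM (ger0_norm (ltW (w0 i))) (le_lt_trans _ Mx)//.
  by rewrite ler_wpM2r.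
have ci i : series (fun k => - (1 / 2) * w i * (- (w i * x)) ^+ k +
    1 / 2 * b i ^+ 2 * w i * (k.+1%:R * (- (w i * x)) ^+ k)) @ \oo -->
    - (1 / 2) * w i * (1 + w i * x)^-1 + 1 / 2 * b i ^+ 2 * w i * (1 + w i * x)^-1 ^+ 2.
  have c1 := cvg_geometric (yi i); have c2 := cvg_diff_geometric (yi i).
  rewrite opprK in c1 c2.
  have E1 : series (fun k => - (1 / 2) * w i * (- (w i * x)) ^+ k +
      1 / 2 * b i ^+ 2 * w i * (k.+1%:R * (- (w i * x)) ^+ k)) =
    (fun N => - (1 / 2) * w i * series (fun k => (- (w i * x)) ^+ k) N +
      1 / 2 * b i ^+ 2 * w i * series (fun k => k.+1%:R * (- (w i * x)) ^+ k) N).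
    by apply/funext => N; rewrite /series/= !mulr_sumr -big_split.
  by rewrite E1; apply: cvgD; apply: cvgMr.
have := @cvg_sum_seq R _ (index_enum 'I_n) _ _ ci.
apply: cvg_trans; apply: near_eq_cvg; apply: nearW => N.
rewrite /series/= exchange_big/=; apply: eq_bigr => k _.
rewrite /dd eE// mulrA mulr_sumr mulr_suml; apply: eq_bigr => i _.
have -> : (- (w i * x)) ^+ k = (-1) ^+ k * w i ^+ k * x ^+ k.
  by rewrite -!exprMn -mulrA mulN1r.
by rewrite !exprS; ring.
Qed.

Let f (x : R) := limn (pseries a x).

Let cvg_f (x : R) : K * `|x| < 1 -> pseries a x @ \oo --> f x.
Proof. by move=> Kx; exact: (pseries_cvg K0 ab). Qed.

(** Multiplied by k + 1, the recurrence for c_(k+1) says that the derived coefficients of f form the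
    Cauchy product of [a] and [dd]. *)
Let df (x : R) : 8 * K * `|x| < 1 -> 0 <= x -> is_derive x (1 : R) f (f x * E' x).
Proof.
move=> Kx x0; have := pseries_is_derive K0 ab Kx.
have Kx1 : K * `|x| < 1.
  have : 0 <= K * `|x| by rewrite mulr_ge0// ltW.
  by move: Kx; rewrite -mulrA; lra.
have Mx1 : M * `|x| < 1 by rewrite (le_lt_trans _ Kx1)// ler_wpM2r.
have Kx0 : 0 <= K * `|x| by rewrite mulr_ge0// ltW.
suff -> : limn (pseries (pseries_diffs a) x) = f x * E' x by [].
apply/cvg_lim => //.
have q01 : 0 <= K * `|x| < 1 by rewrite Kx0.
have b1 k : `|a k * x ^+ k| <= `|c 0%N| * (K * `|x|) ^+ k.
  by rewrite normrM normrX exprMn mulrA ler_wpM2r// exprn_ge0.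
have b2 k : `|dd k * x ^+ k| <= A * M * (K * `|x|) ^+ k.
  rewrite normrM normrX exprMn mulrA ler_wpM2r ?exprn_ge0//.
  apply: (le_trans (ddb k)); rewrite ler_wpM2l ?mulr_ge0 ?(ltW M0)//.
  by rewrite lerXn2r ?nnegrE ?(ltW M0) ?(ltW K0).
have := cauchy_product_geometric q01 b1 b2 (cvg_f Kx1) (cvg_dd Mx1 x0).
apply: cvg_trans; apply: near_eq_cvg; apply: nearW => N; apply: eq_bigr => k _.
transitivity (k.+1%:R * ((-1) ^+ k.+1 * c k.+1) * x ^+ k); last by [].
apply/esym; rewrite cE// mulrCA mul1r.
rewrite mulVKf ?pnatr_eq0// mulr_sumr mulr_suml.
apply: eq_big_nat => i /andP[_ ik]; rewrite /a /dd subSn//.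
have -> : x ^+ k = x ^+ i * x ^+ (k - i) by rewrite -exprD subnKC.
have -> : (-1) ^+ k.+1 = (-1) ^+ i * (-1) ^+ (k - i).+1 :> R.
  by rewrite -exprD addnS subnKC.
by ring.
Qed.

(** f exp(- E) has zero derivative near 0 on the right and takes the value c_0 at 0. *)
Lemma exp_recurrence_sum : exists2 s0, 0 < s0 & forall x, 0 <= x <= s0 ->
  series (fun k => (-1) ^+ k * c k * x ^+ k) @ \oo --> c 0%N * expR (E x).
Proof.
(* Half the radius 1 / (8 K) of [df], so that the closed endpoint is covered. *)
exists (16 * K)^-1; first by rewrite invr_gt0 mulr_gt0.
have small x : 0 <= x <= (16 * K)^-1 -> 8 * K * `|x| < 1.
  move=> /andP[x0 xs]; rewrite ger0_norm//.
  apply: (@le_lt_trans _ _ (8 * K * (16 * K)^-1)).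
    by rewrite ler_wpM2l// mulr_ge0// ltW.
  rewrite (_ : 8 * K * (16 * K)^-1 = 1 / 2); first lra.
  by field; rewrite gt_eqF.
move=> x xs; have /andP[x0 xs0] := xs.
suff <- : f x = c 0%N * expR (E x).
  apply: cvg_f; have := small _ xs.
  have : 0 <= K * `|x| by rewrite mulr_ge0// ltW.
  by rewrite -mulrA; lra.
pose g := f * (@expR R \o (- E)).
have dg y : 0 <= y <= x -> is_derive y (1 : R) g 0.
  move=> /andP[y0 yx].
  have d1 : is_derive y (1 : R) f (f y * E' y).
    by apply: df => //; apply: small; rewrite y0 (le_trans yx).
  have d2 := dE y0.
  by apply: is_derive_eq; rewrite /GRing.scale/= ?fctE; ring.
have [||z _] := @MVT_segment R g (cst 0) 0 x x0.
- by move=> y; rewrite in_itv/= => /andP[y0 yx]; apply: dg; rewrite !ltW.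
- apply: derivable_within_continuous => y; rewrite in_itv/= => yx.
  by have [] := dg _ yx.
rewrite mul0r => /eqP; rewrite subr_eq0 /g !fctE/= => /eqP gE.
have E0 : E 0 = 0.
  by rewrite /E big1// => i _; rewrite mulr0 addr0 ln1 invr1 subrr !mulr0 addr0.
have f0 : f 0 = c 0%N.
  apply/cvg_lim => //; apply: cvg_near_cst; exists 1%N => // N /= N1.
  rewrite /pseries /series/= big_ltn// expr0 mulr1 big_nat_cond big1.
    by rewrite addr0 /a expr0 mul1r.
  by move=> i /andP[/andP[i1 _] _]; rewrite expr0n gtn_eqF// mulr0.
rewrite E0 oppr0 expR0 mulr1 f0 in gE.
by rewrite -gE -mulrA -expRD addNr expR0 mulr1.
Qed.

End exp_recurrence_sum.

(** * Laplace transforms of Gamma-normalized power series *)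

Section gamma.
Variable R : realType.
Local Notation mu := (@lebesgue_measure R).
Implicit Types (a s t T : R).

Lemma continuous_powR a t : 0 < t -> {for t, continuous (fun x : R => x `^ a)}.
Proof.
move=> t0; apply: differentiable_continuous; apply/derivable1_diffP.
by have [] := is_derive1_powR a t0.
Qed.

Lemma powR_expR_within_continuous a : 0 < a ->
  {within `[0, +oo[, continuous (fun t : R => t `^ a * expR (- t))}.
Proof.
move=> a0; have ce t : {for t, continuous (fun t : R => expR (- t))}.
  apply: (@continuous_comp _ _ _ -%R expR); last exact: continuous_expR.
  by apply: cvgN; exact: cvg_id.
apply/continuous_within_itvcyP; split.
  move=> t; rewrite in_itv/= andbT => t0; apply: cvgM; last exact: ce.
  exact: continuous_powR.
rewrite powR0 ?gt_eqF// mul0r -[X in _ --> X](mul0r (expR (- 0))); apply: cvgM.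
  exact: powR_cvg0.
by apply: cvg_at_right_filter; exact: ce.
Qed.

Lemma measurable_powR_expR a s (D : set R) :
  measurable_fun D (fun t : R => t `^ a * expR (- (s * t))).
Proof.
apply: measurable_funTS; apply: measurable_funM; first exact: measurable_powR.
by apply: measurableT_comp => //; apply: measurableT_comp.
Qed.

Lemma powR_expR_le a : 0 <= a -> exists2 C, 0 <= C &
  forall t, 0 < t -> t `^ a * expR (- t) <= C * expR (- (1 / 2 * t)).
Proof.
move=> a0; pose N := Num.trunc a.
have aN : a <= N.+1%:R by rewrite ltW// truncnS_gt.
(* The 1 serves t <= 1. For t > 1, t^a <= t^(N+1), which the term of degree N + 1 in the series of
   exp(t / 2) controls. *)
exists (1 + N.+1`!%:R * 2 ^+ N.+1) => [|t t0].
  by rewrite addr_ge0// mulr_ge0// exprn_ge0.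
have h : t `^ a <= (1 + N.+1`!%:R * 2 ^+ N.+1) * expR (1 / 2 * t).
  have p1 : 1 <= expR (1 / 2 * t).
    by rewrite -expR0 ler_expR mulr_ge0// ltW.
  have [t1|t1] := leP t 1.
    apply: (@le_trans _ _ 1); last first.
      by rewrite mulr_ege1// lerDl mulr_ge0// exprn_ge0.
    have : t `^ a <= 1 `^ a by rewrite ge0_ler_powR ?nnegrE// ltW.
    by rewrite powR1.
  apply: (le_trans (ler_powR (ltW t1) aN)); rewrite powR_mulrn ?(ltW t0)//.
  rewrite mulrDl [1 * _]mul1r ler_wpDl ?expR_ge0//.
  have x0 : 0 <= 1 / 2 * t by rewrite mulr_ge0// ltW.
  have := expR_ge1Dxn N x0.
  have -> : t ^+ N.+1 = 2 ^+ N.+1 * (1 / 2 * t) ^+ N.+1.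
    by rewrite -exprMn; congr (_ ^+ _); field.
  set y := (1 / 2 * t) ^+ N.+1; set E := expR _ => hE.
  have f0 : 0 < N.+1`!%:R :> R by rewrite ltr0n fact_gt0.
  have : y <= N.+1`!%:R * E.
    rewrite mulrC -ler_pdivrMr//; apply: le_trans hE; rewrite lerDr//.
  have p2 : 0 <= 2 ^+ N.+1 :> R by rewrite exprn_ge0.
  by move=> yE; rewrite [leRHS]mulrAC [leRHS]mulrC ler_wpM2l.
apply: (le_trans (ler_wpM2r (expR_ge0 _) h)).
rewrite -[leLHS]mulrA -expRD ler_wpM2l ?ler_expR//.
by rewrite le_eqVlt; apply/orP; left; apply/eqP; field.
Qed.

Lemma Gamma_integrable a : 0 <= a ->
  mu.-integrable `]0, +oo[ (fun t => (t `^ a * expR (- t))%:E).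
Proof.
move=> a0; have [C C0 hC] := powR_expR_le a0.
have m1 (D : set R) : measurable_fun D (fun t : R => t `^ a * expR (- t)).
  by have := @measurable_powR_expR a 1 D; under eq_fun do rewrite mul1r.
have ie : mu.-integrable `]0, +oo[ (fun t => (expR (- (1 / 2 * t)))%:E).
  apply/integrableP; split.
    apply/measurable_EFinP; apply: measurable_funTS.
    by apply: measurableT_comp => //; apply: measurableT_comp.
  under eq_integral do rewrite gee0_abs ?lee_fin ?expR_ge0//.
  rewrite integral_itv_obnd_cbnd; last first.
    apply/measurable_EFinP; apply: measurable_funTS.
    by apply: measurableT_comp => //; apply: measurableT_comp.
  by rewrite integral_expR_tail ?ltry//; lra.
apply: le_integrable (integrableZl _ C ie) => //; first by apply/measurable_EFinP; exact: m1.
move=> t /=; rewrite in_itv/= andbT => t0; rewrite lee_fin.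
rewrite ger0_norm ?mulr_ge0 ?powR_ge0 ?expR_ge0//.
by rewrite ger0_norm ?hC// mulr_ge0 ?expR_ge0.
Qed.

Lemma GammaE a : 0 <= a ->
  (\int[mu]_(t in `]0%R, +oo[) (t `^ a * expR (- t))%:E = (Gamma (a + 1))%:E)%E.
Proof.
move=> a0; rewrite /Gamma /Rintegral addrK fineK//.
by apply: integrable_fin_num => //; exact: Gamma_integrable.
Qed.

(** Substituting s t for t in Euler's integral extracts s^(a+1); a > 0 makes the integrand
    continuous up to 0. *)
Lemma laplace_powR a s : 0 < a -> 0 < s ->
  (\int[mu]_(t in `]0%R, +oo[) (t `^ a * expR (- (s * t)))%:E =
   (s `^ (- (a + 1)) * Gamma (a + 1))%:E)%E.
Proof.
move=> a0 s0; have mG1 : measurable_fun setT (fun t : R => t `^ a * expR (- t)).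
  by have := @measurable_powR_expR a 1 setT; under eq_fun do rewrite mul1r.
have p0 : 0 < s `^ (a + 1) by exact: powR_gt0.
pose F : R -> R := cst s * id.
have dF (x : R) : is_derive x (1 : R) F s.
  by apply: is_derive_eq; rewrite /GRing.scale/= ?fctE; ring.
have F'E : (F^`())%classic = cst s by apply/funext => x; rewrite derive1E derive_val.
have F0 : F 0 = 0 by rewrite /F fctE mulr0.
have := @increasing_ge0_integration_by_substitutiony R F (fun t => t `^ a * expR (- t)) 0.
rewrite F0 F'E => S.
have {S} : (\int[mu]_(x in `[0%R, +oo[) (x `^ a * expR (- x))%:E =
   \int[mu]_(x in `[0%R, +oo[) ((s `^ (a + 1))%:E * (x `^ a * expR (- (s * x)))%:E))%E.
  rewrite S.
  - apply: eq_integral => x; rewrite inE/= in_itv/= andbT => x0.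
    rewrite -EFinM /F /= !fctE; congr EFin.
    rewrite powRM// ?(ltW s0)// powRD; last by rewrite (gt_eqF s0) implybT.
    by rewrite powRr1 ?(ltW s0)//; ring.
  - by move=> x y _ _ xy; rewrite /F !fctE ltr_pM2l.
  - by move=> x _; exact: cst_continuous.
  - exact: is_cvg_cst.
  - exact: is_cvg_cst.
  - split; first by move=> x _; have [] := dF x.
    apply: cvg_at_right_filter; apply: differentiable_continuous.
    by apply/derivable1_diffP; have [] := dF 0.
  - by apply: gt0_cvgMry.
  - exact: powR_expR_within_continuous.
  - by move=> x _; rewrite mulr_ge0 ?powR_ge0 ?expR_ge0.
rewrite ge0_integralZl//; last 3 first.
- by apply/measurable_EFinP; exact: measurable_powR_expR.
- by move=> x _; rewrite lee_fin mulr_ge0 ?powR_ge0 ?expR_ge0.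
- by rewrite lee_fin ltW.
rewrite -!integral_itv_obnd_cbnd; last 2 first.
- by apply/measurable_EFinP; exact: measurable_powR_expR.
- by apply/measurable_EFinP; exact: measurable_funTS.
rewrite GammaE ?ltW// powRN => H.
apply/eqP; rewrite EFinM; move: H => /(congr1 (fun z => (s `^ (a + 1))^-1%:E * z)%E) ->.
by rewrite muleA -EFinM mulVf ?mul1e ?(gt_eqF p0).
Qed.

(** Restricting Euler's integral to [T, 2 T] suffices. As T is arbitrary, Gamma outgrows every
    geometric sequence. *)
Lemma Gamma_ge a T : 0 <= a -> 0 < T ->
  T `^ a * expR (- (2 * T)) * T <= Gamma (a + 1).
Proof.
move=> a0 T0; rewrite -lee_fin -GammaE//.
have TT : T < 2 * T by lra.
have m1 (D : set R) : measurable_fun D (fun t : R => t `^ a * expR (- t)).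
  by have := @measurable_powR_expR a 1 D; under eq_fun do rewrite mul1r.
apply: (@le_trans _ _ (\int[mu]_(t in `[T, (2 * T)%R]) (t `^ a * expR (- t))%:E)%E);
  last first.
  apply: ge0_subset_integral => //.
  - by apply/measurable_EFinP; exact: m1.
  - by move=> x _; rewrite lee_fin mulr_ge0 ?powR_ge0 ?expR_ge0.
  - by apply: subset_itv; rewrite bnd_simp.
apply: (@le_trans _ _ (\int[mu]_(t in `[T, (2 * T)%R])
  (cst (T `^ a * expR (- (2 * T)))%:E t))%E).
  rewrite integral_cst//= lebesgue_measure_itv/= lte_fin TT -EFinD -EFinM lee_fin.
  by rewrite le_eqVlt; apply/orP; left; apply/eqP; ring.
apply: ge0_le_integral => //.
- by move=> x _; rewrite lee_fin mulr_ge0 ?powR_ge0 ?expR_ge0.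
- by apply/measurable_EFinP; exact: m1.
- move=> x /=; rewrite in_itv/= => /andP[Tx x2]; rewrite lee_fin.
  apply: ler_pM; rewrite ?powR_ge0 ?expR_ge0//.
    by rewrite ge0_ler_powR ?nnegrE ?(ltW T0)// (le_trans (ltW T0)).
  by rewrite ler_expR lerN2.
Qed.

Lemma Gamma_gt0 a : 0 <= a -> 0 < Gamma (a + 1) :> R.
Proof.
move=> a0; apply: lt_le_trans (Gamma_ge a0 (@ltr01 R)).
by rewrite !mulr_gt0 ?powR_gt0 ?expR_gt0.
Qed.

End gamma.

Section gamma_series.
Variables (R : realType) (a : nat -> R) (C K beta : R).
Hypothesis K0 : 0 < K.
Hypothesis ab : forall k, `|a k| <= C * K ^+ k.
Hypothesis beta0 : 0 < beta.
Local Notation mu := (@lebesgue_measure R).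

Let C0 : 0 <= C.
Proof. by apply: le_trans (normr_ge0 (a 0%N)) _; have := ab 0%N; rewrite expr0 mulr1. Qed.

Let u q k := a k * (q `^ (beta + k%:R) / Gamma (beta + k%:R + 1)).
Let g k := a k / Gamma (beta + k%:R + 1).

Let bk0 k : 0 < beta + k%:R.
Proof. by rewrite ltr_pwDl. Qed.

Let G0 k : 0 < Gamma (beta + k%:R + 1) :> R.
Proof. by apply: Gamma_gt0; exact: ltW. Qed.

(** Splitting off the real power leaves an ordinary power series, to which the convergence and
    derivation lemmas apply. *)
Let uE q k : 0 < q -> u q k = q `^ beta * (g k * q ^+ k).
Proof.
move=> q0; rewrite /u /g powRD; last by rewrite (gt_eqF q0) implybT.
by rewrite powR_mulrn ?(ltW q0)//; ring.
Qed.

(* T is free, so the series converge everywhere. *)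
Let gb T : 0 < T ->
  forall k, `|g k| <= C / (T `^ beta * expR (- (2 * T)) * T) * (K / T) ^+ k.
Proof.
move=> T0 k; have GT := Gamma_ge (ltW (bk0 k)) T0.
have p0 : 0 < T `^ (beta + k%:R) * expR (- (2 * T)) * T.
  by rewrite !mulr_gt0 ?powR_gt0 ?expR_gt0.
rewrite /g normrM normfV (gtr0_norm (G0 k)).
apply: (@le_trans _ _ (C * K ^+ k / (T `^ (beta + k%:R) * expR (- (2 * T)) * T))).
  by apply: ler_pM => //; rewrite ?invr_ge0 ?(ltW (G0 k))// lef_pV2 ?posrE.
rewrite powRD; last by rewrite (gt_eqF T0) implybT.
rewrite powR_mulrn ?(ltW T0)// le_eqVlt; apply/orP; left; apply/eqP.
rewrite expr_div_n; field.
by rewrite !gt_eqF ?powR_gt0 ?expR_gt0 ?exprn_gt0.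
Qed.

Let gTx (x : R) : exists2 T, 0 < T & 8 * (K / T) * `|x| < 1.
Proof.
(* The 8 is the margin demanded by [pseries_is_derive]; the 1 makes the inequality strict and T
   positive. *)
exists (8 * K * `|x| + 1); first by rewrite ltr_wpDl// !mulr_ge0// ltW.
have p0 : 0 < 8 * K * `|x| + 1 by rewrite ltr_wpDl// !mulr_ge0// ltW.
rewrite (_ : _ * _ = 8 * K * `|x| / (8 * K * `|x| + 1)).
  by rewrite ltr_pdivrMr// mul1r ltrDl.
by field; rewrite gt_eqF.
Qed.

Let normed_g (x : R) : cvgn [normed pseries g x].
Proof.
have [T T0 Tx] := gTx x; apply: (pseries_normed_cvg _ (gb T0)); first exact: divr_gt0.
have : 0 <= K / T * `|x| by rewrite mulr_ge0// divr_ge0 ?ltW.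
by move: Tx; rewrite -mulrA; lra.
Qed.

Let F q := limn (series (u q)).

Let FE q : 0 < q -> F q = q `^ beta * limn (pseries g q).
Proof.
move=> q0; have cg : cvgn (pseries g q) by apply: normed_cvg; exact: normed_g.
apply/cvg_lim => //.
rewrite (_ : series (u q) = (fun N => q `^ beta * pseries g q N)).
  exact: cvgMr.
apply/funext => N; rewrite /pseries /series/= mulr_sumr.
by apply: eq_bigr => k _; exact: uE.
Qed.

Lemma gamma_series_cvg q : 0 < q -> cvgn (series (u q)).
Proof.
move=> q0; have cg : cvgn (pseries g q) by apply: normed_cvg; exact: normed_g.
rewrite (_ : series (u q) = (fun N => q `^ beta * pseries g q N)).
  by apply: is_cvgM => //; exact: is_cvg_cst.
apply/funext => N; rewrite /pseries /series/= mulr_sumr.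
by apply: eq_bigr => k _; exact: uE.
Qed.

Lemma gamma_series_continuous q : 0 < q -> {for q, continuous F}.
Proof.
move=> q0; have [T T0 Tx] := gTx q.
have KT0 : 0 < K / T by rewrite divr_gt0.
have dg := pseries_is_derive KT0 (gb T0) Tx.
have cg : {for q, continuous (fun x => limn (pseries g x))}.
  by apply: differentiable_continuous; apply/derivable1_diffP; have [] := dg.
have cF : (q' `^ beta * limn (pseries g q')) @[q' --> q] --> q `^ beta * limn (pseries g q).
  by apply: cvgM; [exact: continuous_powR|exact: cg].
rewrite /prop_for /continuous_at FE//; apply: cvg_trans cF.
by apply: near_eq_cvg; near=> q'; rewrite FE//; near: q'; exact: lt_nbhsr.
Unshelve. all: by end_near. Qed.

Variable s : R.
Hypothesis Ks : K < s.
Let s0 : 0 < s. Proof. exact: lt_trans Ks. Qed.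

Let v k (q : R) : R := expR (- (s * q)) * u q k.

Let mv k D : measurable_fun D (v k).
Proof.
rewrite (_ : v k = (fun q => (a k / Gamma (beta + k%:R + 1)) *
    (q `^ (beta + k%:R) * expR (- (s * q))))); last first.
  by apply/funext => q; rewrite /v /u; ring.
by apply: measurable_funM => //; exact: measurable_powR_expR.
Qed.

Let int_absv k : (\int[mu]_(q in `]0%R, +oo[) `|(v k q)%:E| =
  (`|a k| * s `^ (- (beta + k%:R + 1)))%:E)%E.
Proof.
under eq_integral => q _.
  rewrite (_ : `|(v k q)%:E|%E = (`|a k| / Gamma (beta + k%:R + 1))%:E *
      (q `^ (beta + k%:R) * expR (- (s * q)))%:E)%E; last first.
    rewrite -EFinM /=; congr EFin; rewrite /v /u !normrM normfV.
    rewrite (ger0_norm (expR_ge0 _)) (ger0_norm (powR_ge0 _ _)) (gtr0_norm (G0 k)).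
    by ring.
  over.
rewrite ge0_integralZl//; last 3 first.
- by apply/measurable_EFinP; exact: measurable_powR_expR.
- by move=> q _; rewrite lee_fin mulr_ge0 ?powR_ge0 ?expR_ge0.
- by rewrite lee_fin divr_ge0// ltW.
rewrite laplace_powR// -EFinM; congr EFin; field.
by rewrite gt_eqF.
Qed.

Let int_v k : (\int[mu]_(q in `]0%R, +oo[) (v k q)%:E =
  (a k * s `^ (- (beta + k%:R + 1)))%:E)%E.
Proof.
under eq_integral => q _.
  rewrite (_ : (v k q)%:E%E = (a k / Gamma (beta + k%:R + 1))%:E *
      (q `^ (beta + k%:R) * expR (- (s * q)))%:E)%E; last first.
    by rewrite -EFinM; congr EFin; rewrite /v /u; ring.
  over.
rewrite integralZl//; last first.
  apply/integrableP; split.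
    by apply/measurable_EFinP; exact: measurable_powR_expR.
  under eq_integral do rewrite gee0_abs ?lee_fin ?mulr_ge0 ?powR_ge0 ?expR_ge0//.
  by rewrite laplace_powR// ltry.
rewrite laplace_powR// -EFinM; congr EFin; field.
by rewrite gt_eqF.
Qed.

Let iv k : mu.-integrable `]0, +oo[ (fun q => (v k q)%:E).
Proof.
apply/integrableP; split; first by apply/measurable_EFinP; exact: mv.
by rewrite int_absv ltry.
Qed.

Let powsE k : s `^ (- (beta + k%:R + 1)) = s `^ (- (beta + 1)) * s^-1 ^+ k.
Proof.
rewrite (_ : - (beta + k%:R + 1) = - (beta + 1) + - k%:R); last ring.
rewrite powRD; last by rewrite (gt_eqF s0) implybT.
by congr (_ * _); rewrite powR_invn ?(ltW s0)// exprVn.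
Qed.

(** Dominates every partial sum. By Tonelli its integral is, up to a power of s, the sum of the
    |a_k| s^(-k), finite because s > K. *)
Let H q : \bar R := (\sum_(0 <= k <oo) `|(v k q)%:E|)%E.

Let iH : mu.-integrable `]0, +oo[ H.
Proof.
apply/integrableP; split.
  apply: ge0_emeasurable_sum => // k _.
  by apply: measurableT_comp => //; apply/measurable_EFinP; exact: mv.
under eq_integral do rewrite gee0_abs ?nneseries_ge0//.
rewrite integral_nneseries//; last first.
  by move=> k; apply: measurableT_comp => //; apply/measurable_EFinP; exact: mv.
under eq_eseriesr do rewrite int_absv powsE.
have cs : cvgn (series (fun k => `|a k| * (s `^ (- (beta + 1)) * s^-1 ^+ k))).
  have Ks1 : K * `|s^-1| < 1.
    by rewrite normfV (gtr0_norm s0) ltr_pdivrMr// mul1r.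
  rewrite (_ : series _ = (fun N => s `^ (- (beta + 1)) * [normed pseries a s^-1] N)).
    by apply: is_cvgM; [exact: is_cvg_cst|exact: pseries_normed_cvg Ks1].
  apply/funext => N; rewrite /series/= mulr_sumr; apply: eq_bigr => k _.
  by rewrite normrM normrX (@ger0_norm _ s^-1) ?invr_ge0 ?(ltW s0)// mulrCA.
rewrite (_ : (fun n => _) = EFin \o series (fun k => `|a k| * (s `^ (- (beta + 1)) * s^-1 ^+ k))).
  by rewrite EFin_lim// ltry.
by apply/funext => N; rewrite /series/= sumEFin.
Qed.

(** Termwise, Gamma(beta + k + 1) cancels against Euler's integral, leaving a power series in 1/s;
    domination by [H] justifies the exchange. *)
Lemma gamma_series_laplace :
  mu.-integrable `]0, +oo[ (fun q => (expR (- (s * q)) * F q)%:E) /\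
  (\int[mu]_(q in `]0%R, +oo[) (expR (- (s * q)) * F q)%:E =
   (s `^ (- (beta + 1)) * limn (series (fun k => a k * s^-1 ^+ k)))%:E)%E.
Proof.
have mpart N : measurable_fun `](0 : R), +oo[ (fun q => (\sum_(0 <= k < N) v k q)%:E).
  by apply/measurable_EFinP; apply: measurable_sum => k; exact: mv.
have cvgF q : `](0 : R), +oo[%classic q ->
    (\sum_(0 <= k < N) v k q)%:E @[N --> \oo] --> (expR (- (s * q)) * F q)%:E.
  rewrite /= in_itv/= andbT => q0; apply: cvg_EFin; first exact: nearW.
  have c : (fun N => expR (- (s * q)) * series (u q) N) @ \oo --> expR (- (s * q)) * F q.
    by apply: cvgMr; exact: gamma_series_cvg.
  apply: cvg_trans c; apply: near_eq_cvg; apply: nearW => N.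
  by rewrite /= mulr_sumr.
have mF : measurable_fun `](0 : R), +oo[ (fun q => (expR (- (s * q)) * F q)%:E).
  by apply: emeasurable_fun_cvg mpart cvgF.
have m0y : measurable `](0 : R), +oo[ by exact: measurable_itv.
have vH : {ae mu, forall q (N : nat), `](0 : R), +oo[%classic q ->
    (`|(\sum_(0 <= k < N) v k q)%:E| <= H q)%E}.
  apply: aeW => q N q0; rewrite -sumEFin.
  apply: (le_trans (lee_abs_sum _ _ _)).
  exact: nneseries_lim_ge.
have vF : {ae mu, forall q, `](0 : R), +oo[%classic q ->
    (\sum_(0 <= k < N) v k q)%:E @[N --> \oo] --> (expR (- (s * q)) * F q)%:E}.
  by apply: aeW => q; exact: cvgF.
have [iF _ cI] := @dominated_convergence _ _ R mu _ m0y _ _ _ mpart mF vF iH vH.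
split => //; apply: (cvg_unique _ cI) => //.
have -> : [sequence (\int[mu]_(q in `]0%R, +oo[) (\sum_(0 <= k < N) v k q)%:E)%E]_N =
    (fun N => (s `^ (- (beta + 1)) * series (fun k => a k * s^-1 ^+ k) N)%:E).
  apply/funext => N; rewrite /=.
  under eq_integral do rewrite -sumEFin.
  rewrite integral_sum//.
  under eq_bigr do rewrite int_v powsE.
  rewrite sumEFin; congr EFin; rewrite /series/= mulr_sumr.
  by apply: eq_bigr => k _; ring.
apply: cvg_EFin; first exact: nearW.
apply: cvgMr; apply: (pseries_cvg K0 ab).
by rewrite normfV (gtr0_norm s0) ltr_pdivrMr// mul1r.
Qed.

End gamma_series.

(** * The series of the collision probability *)

(** With y = 1 + 1 / (2 l t) one has 1 + 2 t l = t (2 l) y, and the exponent is - b^2 / (2 y) = -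
    b^2 / 2 + b^2 / 2 (1 - 1 / y). The factors free of t are those of c_0. *)
Lemma powRN12_factor (R : realType) (t l m b : R) : 0 < t -> 0 < l ->
    m ^+ 2 = l * b ^+ 2 ->
  (Num.sqrt (1 + 2 * t * l))^-1 * expR (- (t * m ^+ 2 / (1 + 2 * t * l))) =
  t `^ (- (1 / 2)) * ((2 * l) `^ (- (1 / 2)) * (expR (- (1 / 2) * b ^+ 2) *
    expR (- (1 / 2) * ln (1 + (2 * l)^-1 * t^-1) +
      1 / 2 * b ^+ 2 * (1 - (1 + (2 * l)^-1 * t^-1)^-1)))).
Proof.
move=> t0 l0 mE; set y := 1 + (2 * l)^-1 * t^-1.
have l20 : 0 < 2 * l by rewrite mulr_gt0.
have y0 : 0 < y by rewrite ltr_pwDl// mulr_ge0// invr_ge0 ltW.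
have d0 : 0 < 1 + 2 * t * l by rewrite ltr_pwDl// !mulr_ge0// ltW.
have -> : (Num.sqrt (1 + 2 * t * l))^-1 =
    t `^ (- (1 / 2)) * ((2 * l) `^ (- (1 / 2)) * expR (- (1 / 2) * ln y)).
  rewrite -powR12_sqrt ?(ltW d0)// -powRN [- (1 / 2) * _]mulrC expRM lnK ?posrE//.
  rewrite -!powRM ?mulr_ge0 ?(ltW t0) ?(ltW l20) ?(ltW l0) ?(ltW y0)//.
  congr (_ `^ _); last by rewrite div1r.
  by rewrite /y; field; rewrite !gt_eqF.
rewrite mE -!mulrA -!expRD; congr (_ * (_ * _)).
congr expR; rewrite /y; field.
by rewrite (gt_eqF t0) (gt_eqF l0) gt_eqF// ltr_pwDr// !mulr_ge0// ltW.
Qed.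

(** The 1/t of the distribution function and the n factors t^(-1/2) combine into the power that
    [gamma_series_laplace] produces for beta = n / 2. *)
Lemma laplace_product_factor (R : realType) (n : nat) (t : R) (l m b : 'I_n -> R) :
    0 < t -> (forall i, 0 < l i) -> (forall i, m i ^+ 2 = l i * b i ^+ 2) ->
  t^-1 * \prod_(i < n) ((Num.sqrt (1 + 2 * t * l i))^-1 *
    expR (- (t * m i ^+ 2 / (1 + 2 * t * l i)))) =
  t `^ (- (n%:R / 2 + 1)) * (expR (- (1 / 2) * \sum_(i < n) b i ^+ 2) *
    \prod_(i < n) (2 * l i) `^ (- (1 / 2)) *
    expR (\sum_(i < n) (- (1 / 2) * ln (1 + (2 * l i)^-1 * t^-1) +
      1 / 2 * b i ^+ 2 * (1 - (1 + (2 * l i)^-1 * t^-1)^-1)))).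
Proof.
move=> t0 l0 mE.
under eq_bigr do rewrite (powRN12_factor t0 (l0 _) (mE _)).
rewrite mulr_sumr !expR_sum !big_split/= prodr_const card_ord.
have -> : t `^ (- (n%:R / 2 + 1)) = t^-1 * (t `^ (- (1 / 2))) ^+ n.
  rewrite -powR_mulrn ?powR_ge0// -powRrM -[t^-1](powR_inv1 (ltW t0)).
  rewrite -powRD; last by rewrite (gt_eqF t0) implybT.
  by congr (_ `^ _); field.
by ring.
Qed.

Section cumulative_distribution.
Context d (T : measurableType d) (R : realType) (Pr : probability T R).
Variable Q : T -> R.
Hypothesis mQ : measurable_fun setT Q.

Let X : {RV Pr >-> R} := @mfun_Sub _ _ _ R _ (mem_set mQ).

Let cdfE q : fine (Pr [set w | Q w <= q]) = fine (cdf X q).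
Proof.
by rewrite /cdf /distribution /pushforward; congr (fine (Pr _)).
Qed.

Lemma measurable_fine_cdf :
  measurable_fun setT (fun q : R => fine (Pr [set w | Q w <= q])).
Proof.
under eq_fun do rewrite cdfE.
by apply: measurableT_comp => //; exact: cdf_measurable.
Qed.

Lemma fine_cdf_right_continuous (q : R) :
  fine (Pr [set w | Q w <= x]) @[x --> q^'+] --> fine (Pr [set w | Q w <= q]).
Proof.
under eq_fun do rewrite cdfE; rewrite cdfE.
apply: fine_cvg; rewrite fineK; first exact: cdf_right_continuous.
exact: fin_num_measure.
Qed.

End cumulative_distribution.

Section collision_probability.
Context (R : realType) d (T : measurableType d) (Pr : probability T R).
Variables (n : nat) (Q : T -> R) (l b : 'I_n -> R) (c e : nat -> R).
Hypothesis n1 : (1 <= n)%N.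
Hypothesis mQ : measurable_fun setT Q.
Hypothesis Q0 : forall w, 0 <= Q w.
Hypothesis l0 : forall i, 0 < l i.
Hypothesis laplaceQ : forall t, 0 < t ->
  (\int[Pr]_w (expR (- (t * Q w)))%:E =
   (\prod_i ((Num.sqrt (1 + 2 * t * l i))^-1 *
     expR (- (t * (Num.sqrt (l i) * b i) ^+ 2 / (1 + 2 * t * l i)))))%:E)%E.
Hypothesis c0E : c 0%N = expR (- (1 / 2) * \sum_(i < n) b i ^+ 2) *
  \prod_(i < n) (2 * l i) `^ (- (1 / 2)).
Hypothesis eE : forall k, (1 <= k)%N ->
  e k = 1 / 2 * \sum_(i < n) (1 - k%:R * b i ^+ 2) * (2 * l i) ^- k.
Hypothesis cE : forall k, (1 <= k)%N ->
  c k = 1 / k%:R * \sum_(0 <= i < k) e (k - i)%N * c i.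

Lemma quadratic_form_series (r : R) : 0 < r ->
  let u := fun k : nat => (-1) ^+ k * c k *
    (r `^ (n%:R / 2 + k%:R) / Gamma (n%:R / 2 + k%:R + 1)) in
  cvgn (series u) /\ Pr [set w | Q w <= r] = (limn (series u))%:E.
Proof.
move=> r0 u.
pose w i := (2 * l i)^-1.
have w0 i : 0 < w i by rewrite invr_gt0 mulr_gt0.
have eE' k : (1 <= k)%N -> e k = 1 / 2 * \sum_(i < n) (1 - k%:R * b i ^+ 2) * w i ^+ k.
  by move=> k1; rewrite eE//; congr (_ * _); apply: eq_bigr => i _; rewrite exprVn.
have [K K0 cK] := exp_recurrence_growth w0 eE' cE.
pose a k := (-1) ^+ k * c k.
have aK k : `|a k| <= `|c 0%N| * K ^+ k by rewrite normrM normrX normrN1 expr1n mul1r.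
have beta0 : 0 < n%:R / 2 :> R by rewrite divr_gt0// ltr0n.
split; first exact: (gamma_series_cvg K0 aK beta0 r0).
pose F q := limn (series (fun k => a k *
  (q `^ (n%:R / 2 + k%:R) / Gamma (n%:R / 2 + k%:R + 1)))).
pose H q := fine (Pr [set w | Q w <= q]).
have [x0 x00 sumc] := exp_recurrence_sum w0 eE' cE.
(* Beyond K the series may be integrated termwise; beyond 1 / x0 the point 1/s lies where the closed
   form is known. *)
pose s0 := K + x0^-1.
have s00 : 0 < s0 by rewrite addr_gt0// invr_gt0.
have Ks s : s0 <= s -> K < s.
  by apply: lt_le_trans; rewrite ltrDl invr_gt0.
have lapF s (ss : s0 <= s) := gamma_series_laplace K0 aK beta0 (Ks s ss).
have lapH s : 0 < s -> (\int[lebesgue_measure]_(q in `]0%R, +oo[)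
    (expR (- (s * q)) * H q)%:E = (s^-1 * (\prod_i ((Num.sqrt (1 + 2 * s * l i))^-1 *
     expR (- (s * (Num.sqrt (l i) * b i) ^+ 2 / (1 + 2 * s * l i))))))%:E)%E.
  by move=> sp; rewrite laplace_cdfE// laplaceQ// EFinM.
have iH s : 0 < s -> lebesgue_measure.-integrable `]0, +oo[
    (fun q => (expR (- (s * q)) * H q)%:E).
  move=> sp; apply/integrableP; split.
    apply/measurable_EFinP; apply: measurable_funTS.
    apply: measurable_funM; last exact: measurable_fine_cdf.
    by apply: measurableT_comp => //; apply: measurableT_comp.
  under eq_integral do rewrite gee0_abs ?lee_fin ?mulr_ge0 ?expR_ge0 ?fine_ge0//.
  by rewrite lapH// ltry.
have mE i : (Num.sqrt (l i) * b i) ^+ 2 = l i * b i ^+ 2.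
  by rewrite exprMn sqr_sqrtr// ltW.
suff : H r - F r = 0.
  move/eqP; rewrite subr_eq0 => /eqP HF.
  rewrite -[RHS]/((F r)%:E) -HF /H fineK// fin_num_measure//.
  rewrite -[X in measurable X]setTI; exact: (measurable_fun_le measurableT).
have DE s : (fun q => (expR (- (s * q)) * (H q - F q))%:E) =
    (fun q => (expR (- (s * q)) * H q)%:E - (expR (- (s * q)) * F q)%:E)%E.
  by apply/funext => q; rewrite -EFinB mulrBr.
apply: (@lerch_right_continuous R (fun q => H q - F q) s0 r) => //.
- rewrite DE; apply: integrableB => //; first exact: iH.
  by have [] := lapF _ (lexx s0).
- move=> s ss; have sp := lt_le_trans s00 ss.
  have [iF LF] := lapF _ ss.
  rewrite DE integralB//; last exact: iH.
  rewrite lapH// LF (laplace_product_factor sp l0 mE) -c0E.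
  have xs : 0 <= s^-1 <= x0.
    rewrite invr_ge0 (ltW sp)/= -[leRHS]invrK lef_pV2 ?posrE ?invr_gt0//.
    by rewrite (le_trans _ ss)// lerDr ltW.
  by rewrite (cvg_lim _ (sumc _ xs))// -EFinB subrr.
- apply: cvgB; first exact: fine_cdf_right_continuous.
  apply: cvg_at_right_filter.
  exact: (gamma_series_continuous K0 aK beta0 r0).
Qed.

End collision_probability.

Theorem mainTheorem2
  (R : realType) (d : measure_display) (T : measurableType d)
  (Pr : probability T R)
  (n : nat) (n_ge1 : (1 <= n)%N)
  (r1 s1 : R) (r1_gt0 : 0 < r1) (s1_gt0 : 0 < s1)
  (x s : {RV Pr >-> n.-tuple R})
  (mu sbar : 'cV[R]_n) (Sigmax Sigmas Sigma : 'M[R]_n)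
  (x_gaussian : gaussian x mu Sigmax)
  (s_gaussian : gaussian s sbar Sigmas)
  (xs_independent : independent x s)
  (SigmaE : Sigma = Sigmax + Sigmas)
  (Sigma_posdef : posdef Sigma)
  (P : 'M[R]_n) (P_orthogonal : P^T *m P = 1%:M)
  (lambda : 'rV[R]_n) (P_diag : P^T *m Sigma *m P = diag_mx lambda)
  (b : 'cV[R]_n) (bE : b = P^T *m invmx (pd_sqrt Sigma) *m (mu - sbar))
  (c e : nat -> R)
  (c0E : c 0%N = expR (- (1 / 2) * \sum_(i < n) b i 0 ^+ 2) *
                 \prod_(i < n) (2 * lambda 0 i) `^ (- (1 / 2)))
  (eE : forall k : nat, (1 <= k)%N ->
     e k = 1 / 2 * \sum_(i < n) (1 - k%:R * b i 0 ^+ 2) * (2 * lambda 0 i) ^- k)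
  (cE : forall k : nat, (1 <= k)%N ->
     c k = 1 / k%:R * \sum_(0 <= i < k) e (k - i)%N * c i) :
  let u := fun k : nat =>
    (-1) ^+ k * c k *
    (((r1 + s1) ^+ 2) `^ (n%:R / 2 + k%:R) / Gamma (n%:R / 2 + k%:R + 1)) in
  cvgn (series u) /\
  Pr [set w | enorm (colvec (x w) - colvec (s w)) ^+ 2 <= (r1 + s1) ^+ 2] =
    (limn (series u))%:E.
Proof.
have l0 := orthogonal_diag_gt0 P_orthogonal Sigma_posdef P_diag.
have mb := mahalanobis_coord P_orthogonal Sigma_posdef P_diag bE.
apply: (@quadratic_form_series R d T Pr n _ (lambda 0) (b^~ 0) c e) => //.
- under eq_fun do rewrite enorm_sqr dotpE.
  apply: measurable_sum => i.
  have my : measurable_fun setT (fun w => (colvec (x w) - colvec (s w)) i 0).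
    under eq_fun do rewrite mxE [X in _ + X]mxE.
    by apply: measurable_funB; apply: measurable_colvec; exact: measurable_funPT.
  exact: measurable_funM.
- by move=> w; exact: sqr_ge0.
- move=> t t0; rewrite SigmaE in Sigma_posdef P_diag.
  rewrite (laplace_sqr_enorm x_gaussian s_gaussian xs_independent n_ge1 t0
    Sigma_posdef P_orthogonal P_diag).
  congr EFin; apply: eq_bigr => i _.
  (* The transform sees the rotated mean only through its squared coordinates, which are l_i
     b_i^2. *)
  by rewrite mb exprMn sqr_sqrtr// ltW.
- by rewrite exprn_gt0// addr_gt0.
Qed.
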